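(* For each $n$ let $\mathcal C_n$ be a conjugacy class of $S_n$ with $\mathrm{supp}(\mathcal C_n)\to\infty$ as $n\to\infty$, and set $t_n=\frac n2\log n$. Then for every $\epsilon>0$: (1) if every $\mathcal C_n$ consists of odd permutations, $\lim_{n\to\infty}d_2\big(h_{\mathcal C_n,(1+\epsilon)t_n},u_n\big)=0$, where $u_n$ is uniform on $S_n$; (2) if every $\mathcal C_n$ consists of even permutations, $\lim_{n\to\infty}d_2\big(h_{\mathcal C_n,(1+\epsilon)t_n},\overline u_n\big)=0$, where $\overline u_n$ is uniform on $A_n$.
   Context: For a conjugacy class $\mathcal C$ of $S_n$, $q_{\mathcal C}$ is the uniform probability measure on $\mathcal C$ and $\mathrm{supp}(\mathcal C)$ is the number of points not fixed by an element of $\mathcal C$. $h_{\mathcal C,t}=e^{-t}\sum_{k\ge0}\frac{t^k}{k!}q_{\mathcal C}^{(k)}$ with $q^{(k)}$ the $k$-fold convolution power. On a finite group $G$ with uniform measure $u$, $d_2(p,u)=\big(|G|\sum_{x\in G}|p(x)-u(x)|^2\big)^{1/2}$ (with $G=S_n$ in (1) and $G=A_n$ in (2)). *)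

(* Defs.v *)
From mathcomp Require Import all_boot all_fingroup.
From mathcomp Require Import alt.
From Stdlib Require Import Reals ClassicalEpsilon Factorial.

Set Implicit Arguments.
Unset Strict Implicit.
Unset Printing Implicit Defensive.

Local Open Scope R_scope.

Definition Sfun (n : nat) := {perm 'I_n} -> R.

(* supp(C): number of points not fixed by an element of C (we use the
   canonical representative repr C; all elements of a class have the same
   support size). *)
Definition supp (n : nat) (C : {set {perm 'I_n}}) : nat :=
  #|[set i : 'I_n | repr C i != i]|.

Definition unif (n : nat) (A : {set {perm 'I_n}}) : Sfun n :=
  fun x => if x \in A then / INR #|A| else 0.

Definition delta1 (n : nat) : Sfun n := fun x => if x == 1%g then 1 else 0.

Definition conv (n : nat) (p q : Sfun n) : Sfun n :=
  fun x => \big[Rplus/0]_(y : {perm 'I_n}) (p y * q (y^-1 * x)%g).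

Fixpoint convpow (n : nat) (q : Sfun n) (k : nat) : Sfun n :=
  match k with
  | 0%nat => @delta1 n
  | k'.+1 => conv (convpow q k') q
  end.

(* Limit of a real sequence (chosen classically; meaningful when it exists). *)
Definition Rlim (u : nat -> R) : R :=
  epsilon (inhabits 0) (fun l => Un_cv u l).

Definition Rseries (a : nat -> R) : R := Rlim (fun N => sum_f_R0 a N).

Definition heat (n : nat) (C : {set {perm 'I_n}}) (t : R) : Sfun n :=
  fun x => exp (- t) *
    Rseries (fun k => t ^ k / INR (fact k) * convpow (unif C) k x).

Definition dist2 (n : nat) (G : {set {perm 'I_n}}) (p u : Sfun n) : R :=
  sqrt (INR #|G| * \big[Rplus/0]_(x in G) ((p x - u x) ^ 2)).

Definition tn (n : nat) : R := INR n / 2 * ln (INR n).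

(* Main.v *)
(* The proof idea, for a representation V of S_n with normalised character r.
   The squared distance is n! sum_x h(x)^2 - 1, a sum over the irreducible V of
   d_V^2 exp(-2t(1 - r_V(C))), and it suffices to bound |r_V(C)|.

   Let B be a block of maximal size such that Sym(B) acts trivially (or by the
   sign) on some f <> 0 in V.  If g moves B, then g f is invariant under the
   symmetric group of (B cap gB) + y for some y outside B, while symmetrising f
   over that group costs a factor |B cap gB| + 1 in the squared norm, because f is
   killed when B is enlarged; hence <f, g f> is small.  So |r_V(g)| is essentially
   the probability that a random conjugate of g preserves B, and a second moment
   computation bounds it by 1 - 4j/n when j = n - |B| is small.  The V with given
   j contribute at most n^(3j) to the sum of the d_V^2.

   If no such block has nearly n points, |r_V(g)|^2 is bounded by an average of
   r_V over commutators of g with the powers of a cycle of bounded length.  These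
   have bounded support: the block argument still applies if some block has at
   least cn points; otherwise a vector adapted to a full greedy chain of blocks
   (a highest weight vector) has <f, k f> small for most conjugates k of any
   nontrivial element of bounded support.  Then |r_V(g)| <= 1/M, and the
   contribution of all these V is at most n! n^(-n).

   V is realised as the isotypic component of V in the functions on S_n, so that
   no representation theory of the symmetric group is needed.  *)
From HB Require Import structures.
From Stdlib Require Import Reals ClassicalEpsilon Factorial.
Require Import Defs.
From mathcomp Require Import all_boot all_order all_fingroup all_algebra all_field all_character.
From mathcomp Require Import alt.
From mathcomp Require Import boolp.
From mathcomp Require Import Rstruct.
From mathcomp Require Import ring lra zify.
Set Implicit Arguments. Unset Strict Implicit. Unset Printing Implicit Defensive.
Import Order.TTheory GRing.Theory Num.Theory.
Local Open Scope ring_scope.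

(** * Numerical inequalities behind the character bounds *)

Lemma near_trivial_arith (F : realFieldType) (P b j n : F) :
  n = b + j -> 0 <= j -> 40 * j <= n -> 200 <= n ->
  P <= 1 - 2 * (1 / 2) * (10 * (j * b / (n * (n - 1))))
    + (1 / 2) ^+ 2 * (10 * (j * b / (n * (n - 1))) +
       10 ^+ 2 * ((j * b) ^+ 2 / (n * (n - 1) * (n - 2) * (n - 3)))) ->
  P + (1 - P) / 10 <= 1 - 4 * j / n.
Proof.
move=> e j0 jn n200 HP.
have n0 : 0 < n by lra.
(* In terms of [a], the pair probability is at least 39[a]/40 and the quadruple one at most 2[a]^2,
   so [P] <= 1 - 6[a], which is ample since [a] <= 1/40. *)
have [a ea] : exists a, a = j / n by exists (j / n).
have a0 : 0 <= a by rewrite ea divr_ge0 // ltW.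
have a40 : a <= 1 / 40 by rewrite ea ler_pdivrMr //; lra.
have ej : j = a * n by rewrite ea divfK ?lt0r_neq0.
have eb : b = (1 - a) * n by lra.
have p1 : 39 / 40 * a <= j * b / (n * (n - 1)).
  rewrite ler_pdivlMr ?mulr_gt0 //; last lra.
  rewrite ej eb.
  have -> : a * n * ((1 - a) * n) = a * n * (n * (1 - a)) by ring.
  have -> : 39 / 40 * a * (n * (n - 1)) = a * n * (39 / 40 * (n - 1)) by ring.
  have h : a * n <= 1 / 40 * n by rewrite ler_wpM2r // ltW.
  by apply: ler_wpM2l; [rewrite mulr_ge0 // ltW | lra].
have p2 : (j * b) ^+ 2 / (n * (n - 1) * (n - 2) * (n - 3)) <= 2 * a ^+ 2.
  rewrite ler_pdivrMr; last by rewrite !mulr_gt0 //; lra.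
  have bn : b ^+ 2 <= n ^+ 2 by rewrite ler_pXn2r ?nnegrE //; lra.
  have h3 : n ^+ 3 <= 2 * ((n - 1) * (n - 2) * (n - 3)).
    have -> : 2 * ((n - 1) * (n - 2) * (n - 3)) = n ^+ 3 + (n ^+ 2 * (n - 12) + 22 * n - 12) by ring.
    by rewrite lerDl -addrA addr_ge0 ?mulr_ge0 ?sqr_ge0 //; lra.
  have -> : 2 * a ^+ 2 * (n * (n - 1) * (n - 2) * (n - 3)) =
     (a ^+ 2 * n) * (2 * ((n - 1) * (n - 2) * (n - 3))) by ring.
  apply: (@le_trans _ _ ((a ^+ 2 * n) * n ^+ 3)); last by rewrite ler_wpM2l // mulr_ge0 ?sqr_ge0 // ltW.
  rewrite ej [X in X <= _](_ : _ = a ^+ 2 * n ^+ 2 * b ^+ 2); last by ring.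
  rewrite [X in _ <= X](_ : _ = a ^+ 2 * n ^+ 2 * n ^+ 2); last by ring.
  by rewrite ler_wpM2l // mulr_ge0 ?sqr_ge0.
have -> : 4 * j / n = 4 * a by rewrite ea mulrA.
have a2 : a ^+ 2 <= a / 40 by rewrite expr2 ler_wpM2l //; lra.
move: (j * b / (n * (n - 1))) ((j * b) ^+ 2 / (n * (n - 1) * (n - 2) * (n - 3))) p1 p2 HP.
by move=> p q p1 p2 HP; lra.
Qed.

(** This is Chebyshev: the multiplier is the inverse of the mean [m * p], which leaves 1/([m * p])
    plus the relative excess of the quadruple probability over [p]^2. The excess is at most
    8/[n]. *)
Lemma mid_arith (F : realFieldType) (P b j n m W : F) : n = b + j -> 200 <= n -> 1 <= W ->
  n <= 40 * j -> n <= W * b -> 0 < m ->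
  let p := (j * b / (n * (n - 1))) in
  P <= 1 - 2 * (m * p)^-1 * (m * p)
    + ((m * p)^-1) ^+ 2 * (m * p + m ^+ 2 * ((j * b) ^+ 2 / (n * (n - 1) * (n - 2) * (n - 3)))) ->
  P <= 40 * W / m + 8 / n.
Proof.
move=> e n200 W1 jn bn m0 p HP; apply: le_trans HP _.
have n0 : 0 < n by lra.
have j0 : 0 < j by lra.
have b0 : 0 < b by rewrite -(pmulr_rgt0 _ (x := W)); lra.
have p0 : 0 < p by rewrite divr_gt0 ?mulr_gt0 //; lra.
have pW : (40 * W)^-1 <= p.
  rewrite /p ler_pdivlMr ?mulr_gt0 //; last lra.
  rewrite ler_pdivrMl; last lra.
  have : n * n <= (40 * j) * (W * b) by apply: ler_pM; lra.
  lra.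
have ip : p^-1 <= 40 * W by rewrite -[40 * W]invrK lef_pV2 ?posrE // invr_gt0; lra.
set Q := n * (n - 1) * (n - 2) * (n - 3).
have Q0 : 0 < Q by rewrite !mulr_gt0 //; lra.
have -> : 1 - 2 * (m * p)^-1 * (m * p) + (m * p)^-1 ^+ 2 * (m * p + m ^+ 2 * ((j * b) ^+ 2 / Q)) =
  p^-1 / m + ((n * (n - 1)) / ((n - 2) * (n - 3)) - 1).
  rewrite /p /Q; field.
  by rewrite !lt0r_neq0 //; lra.
apply: lerD; first by rewrite ler_wpM2r // invr_ge0 ltW.
rewrite lerBlDr ler_pdivrMr ?mulr_gt0; try lra.
have -> : (8 / n + 1) * ((n - 2) * (n - 3)) = (8 + n) * ((n - 2) * (n - 3)) / n.
  by field; exact: lt0r_neq0.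
rewrite ler_pdivlMr //.
have -> : (8 + n) * ((n - 2) * (n - 3)) = n * (n - 1) * n + (n * (4 * n - 34) + 48) by ring.
by rewrite lerDl addr_ge0 ?mulr_ge0 //; lra.
Qed.
Lemma mid_const_arith (F : realFieldType) (M W n : F) : 0 < M -> 0 < W ->
  64 * M ^+ 2 <= n ->
  40 * W / (320 * M ^+ 2 * W) + 8 / n + 1 / (4 * M ^+ 2) <= (2 * M ^+ 2)^-1.
Proof.
move=> M0 W0 nM; have M2 : 0 < M ^+ 2 by rewrite exprn_gt0.
have h : 8 / n <= 8 / (64 * M ^+ 2).
  by apply: ler_wpM2l; rewrite ?ler0n // lef_pV2 ?posrE //; lra.
have -> : (2 * M ^+ 2)^-1 = 40 * W / (320 * M ^+ 2 * W) + 8 / (64 * M ^+ 2) + 1 / (4 * M ^+ 2).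
  by field; rewrite !lt0r_neq0.
by rewrite lerD2r lerD2l.
Qed.

(** The value of [W] makes the numerator times 2[M]^2 at most [t * W] / 2 <= [n] / 2, and the spare
    factor 2 absorbs [n - 1]. *)
Lemma young_arith (F : realFieldType) (k t W S n M : F) : 0 < M -> 1 <= S -> 200 <= n -> 0 <= k ->
  0 <= t -> k <= S -> t * W <= n -> W = 8 * M ^+ 2 * S ^+ 2 ->
  (k ^+ 2 + k) * t / (n - 1) <= (2 * M ^+ 2)^-1.
Proof.
move=> M0 S1 n200 k0 t0 kS tW eW; have M2 : 0 < M ^+ 2 by rewrite exprn_gt0.
have n1 : 0 < n - 1 by lra.
rewrite ler_pdivrMr // [X in _ <= X]mulrC ler_pdivlMr ?mulr_gt0 //.
have kk : k ^+ 2 + k <= 2 * S ^+ 2.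
  have h1 : k ^+ 2 <= S ^+ 2 by rewrite ler_pXn2r ?nnegrE //; lra.
  have h2 : S <= S ^+ 2 by rewrite expr2 ler_peMl //; lra.
  lra.
have -> : (k ^+ 2 + k) * t * (2 * M ^+ 2) = t * ((k ^+ 2 + k) * (2 * M ^+ 2)) by ring.
have : t * ((k ^+ 2 + k) * (2 * M ^+ 2)) <= t * (2 * S ^+ 2 * (2 * M ^+ 2)).
  by rewrite ler_wpM2l // ler_wpM2r // mulr_ge0 // ltW.
have -> : t * (2 * S ^+ 2 * (2 * M ^+ 2)) = t * W / 2 by rewrite eW; field.
lra.
Qed.

(** * Functions on the symmetric group *)

Section Hilbert.
Variable T : finType.
Notation Sn := {perm T}.
Notation fn := {ffun Sn -> algC^o}.
Implicit Types (f h u w : fn) (g s : Sn) (a : algC).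

(** This is a right action, matching the product of permutations, in which the left factor is
    applied first. *)
Definition trans g f : fn := [ffun x => f (g * x)%g].
Definition dot f h : algC := \sum_x (f x : algC) * (h x : algC)^*.

Lemma transM g s f : trans (s * g) f = trans g (trans s f).
Proof. by apply/ffunP => x; rewrite !ffunE mulgA. Qed.
Lemma trans1 f : trans 1 f = f.
Proof. by apply/ffunP => x; rewrite !ffunE mul1g. Qed.
Lemma trans_is_linear g : linear (trans g).
Proof. by move=> a f h; apply/ffunP => x; rewrite !ffunE. Qed.
HB.instance Definition _ g := GRing.isLinear.Build algC fn fn *:%R (trans g) (trans_is_linear g).

Lemma dotDl f f' h : dot (f + f') h = dot f h + dot f' h.
Proof. by rewrite -big_split; apply: eq_bigr => x _; rewrite !ffunE mulrDl. Qed.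
Lemma dotC f h : dot h f = (dot f h)^*.
Proof.
by rewrite rmorph_sum; apply: eq_bigr => x _; rewrite rmorphM /= conjCK mulrC.
Qed.
Lemma dotDr f h h' : dot f (h + h') = dot f h + dot f h'.
Proof. by rewrite -big_split; apply: eq_bigr => x _; rewrite !ffunE rmorphD mulrDr. Qed.
Lemma dotZl a f h : dot (a *: f) h = a * dot f h.
Proof. by rewrite mulr_sumr; apply: eq_bigr => x _; rewrite !ffunE mulrA. Qed.
Lemma dotZr a f h : dot f (a *: h) = a^* * dot f h.
Proof. by rewrite mulr_sumr; apply: eq_bigr => x _; rewrite !ffunE rmorphM mulrCA. Qed.
Lemma dot0l h : dot 0 h = 0.
Proof. by rewrite -(scale0r 0) dotZl mul0r. Qed.
Lemma dot0r h : dot h 0 = 0.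
Proof. by rewrite -(scale0r 0) dotZr rmorph0 mul0r. Qed.
Lemma dotNl f h : dot (- f) h = - dot f h.
Proof. by rewrite -scaleN1r dotZl mulN1r. Qed.
Lemma dotNr f h : dot f (- h) = - dot f h.
Proof. by rewrite -scaleN1r dotZr rmorphN1 mulN1r. Qed.
Lemma dot_suml (I : Type) (r : seq I) (P : pred I) (F : I -> fn) h :
  dot (\sum_(i <- r | P i) F i) h = \sum_(i <- r | P i) dot (F i) h.
Proof. by apply: (big_morph (dot^~ h)) => [? ?|]; rewrite ?dotDl ?dot0l. Qed.
Lemma dot_sumr (I : Type) (r : seq I) (P : pred I) (F : I -> fn) h :
  dot h (\sum_(i <- r | P i) F i) = \sum_(i <- r | P i) dot h (F i).
Proof. by apply: (big_morph (dot h)) => [? ?|]; rewrite ?dotDr ?dot0r. Qed.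
Lemma dot_trans g f h : dot (trans g f) (trans g h) = dot f h.
Proof.
by rewrite /dot [RHS](reindex_inj (mulgI g)) /=; apply: eq_bigr => x _; rewrite !ffunE.
Qed.
Lemma dot_transl g f h : dot (trans g f) h = dot f (trans g^-1%g h).
Proof. by rewrite -[RHS](dot_trans g) -transM mulVg trans1. Qed.

Lemma dot_ge0 f : 0 <= dot f f.
Proof. by apply: sumr_ge0 => x _; rewrite -normCK exprn_ge0. Qed.
Lemma dot_eq0 f : dot f f = 0 -> f = 0.
Proof.
move/eqP; rewrite psumr_eq0 => [/allP h|x _]; last by rewrite -normCK exprn_ge0.
apply/ffunP => x; rewrite !ffunE; apply/eqP.
by have /implyP/(_ isT) := h x (mem_index_enum x); rewrite -normCK expf_eq0 normr_eq0.
Qed.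
Lemma dot_gt0 f : f != 0 -> 0 < dot f f.
Proof.
by move=> f0; rewrite lt_def dot_ge0 andbT; apply: contra_neq f0; apply: dot_eq0.
Qed.
Lemma dot_conj f : (dot f f)^* = dot f f.
Proof. by rewrite -dotC. Qed.

Lemma dot_CauchySchwarz u w : `|dot u w| ^+ 2 <= dot u u * dot w w.
Proof.
have [->|w0] := eqVneq w 0; first by rewrite !dot0r normr0 expr0n mulr0.
have a0 := dot_gt0 w0.
have := dot_ge0 (dot w w *: u - dot u w *: w).
rewrite !(dotDl, dotDr, dotNl, dotNr, dotZl, dotZr) dot_conj (dotC u w) normCK.
set x := dot w w; set y := dot u u; set z := dot u w.
rewrite [X in 0 <= X](_ : _ = x * (y * x - z * z^*)); last by ring.
by rewrite -/x in a0; rewrite pmulr_rge0 // subr_ge0.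
Qed.

Lemma dot_trans_le g s f : `|dot (trans g f) (trans s f)| <= dot f f.
Proof.
rewrite -(@ler_pXn2r _ 2) ?nnegrE ?normr_ge0 ?dot_ge0 //.
by apply: le_trans (dot_CauchySchwarz _ _) _; rewrite !dot_trans expr2.
Qed.
End Hilbert.

(** * Vectors on which the symmetric group of a block acts by a sign *)

Section Invariant.
Variable T : finType.
Notation Sn := {perm T}.
Notation fn := {ffun Sn -> algC^o}.
Implicit Types (f h u w : fn) (g s : Sn) (a : algC) (b : bool) (A B U : {set T}).

(** [b] selects the trivial or the sign character of Sym([B]). The condition [x != y] matters for
    the sign, since [tperm x x] is the identity. *)
Definition invar b B f :=
  forall x y, x \in B -> y \in B -> x != y -> trans (tperm x y) f = (-1) ^+ b *: f.

Lemma invarS b A B f : A \subset B -> invar b B f -> invar b A f.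
Proof. by move=> /subsetP sAB fB x y Ax Ay; apply: fB; apply: sAB. Qed.

Lemma invar_trans b B f g : invar b B f -> invar b (g @: B) (trans g f).
Proof.
move=> fB _ _ /imsetP[x Bx ->] /imsetP[y By ->] ne; rewrite -transM -tpermJ.
rewrite conjgE mulKVg transM fB ?linearZ //.
by apply: contra_neq ne => ->.
Qed.

Lemma invarZ b B f a : invar b B f -> invar b B (a *: f).
Proof. by move=> fB x y Bx By ne; rewrite linearZ /= fB // !scalerA mulrC. Qed.
Lemma invarD b B f h : invar b B f -> invar b B h -> invar b B (f + h).
Proof. by move=> fB hB x y Bx By ne; rewrite linearD /= fB // hB // scalerDr. Qed.

(** The identity and the [tperm z y] represent the cosets of Sym([B]) in Sym([y |: B]), so this is
    the unnormalised (anti)symmetriser for a vector already adapted to [B]. *)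
Definition spread b B y f := f + (-1) ^+ b *: \sum_(z in B) trans (tperm z y) f.

Lemma invar_spread b B y f : y \notin B -> invar b B f -> invar b (y |: B) (spread b B y f).
Proof.
move=> By fB.
(* [tperm u y] exchanges [f] with the term of [u]. It multiplies each other term by the sign,
   because moving it past [tperm z y] turns it into [tperm u z]. *)
have key (u : T) : u \in B -> trans (tperm u y) (spread b B y f) = (-1) ^+ b *: spread b B y f.
  move=> Bu; rewrite /spread linearD linearZ linear_sum scalerDr scalerA /=.
  rewrite -signr_addb addbb scale1r (bigD1 u) //= -transM tperm2 trans1.
  rewrite [in RHS](bigD1 u) //= scalerDr addrCA.
  congr (_ + (_ + _)); rewrite scaler_sumr; apply: eq_bigr => z /andP[Bz zu].
  have -> : trans (tperm u y) (trans (tperm z y) f) = trans (tperm z y) (trans (tperm u z) f).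
    rewrite -!transM; congr (trans _ f).
    have uy : u != y by apply: contraNneq By => <-.
    by rewrite [RHS]conjgC tpermJ tpermL tpermD // eq_sym.
  by rewrite fB 1?eq_sym // linearZ /= scalerA -signr_addb addbb scale1r.
move=> u v; rewrite !in_setU1 => /orP[/eqP->|Bu] /orP[/eqP->|Bv]; rewrite ?eqxx // => ne.
- by rewrite tpermC key.
- by rewrite key.
rewrite /spread linearD linearZ linear_sum scalerDr /= fB //; congr (_ + _).
rewrite scalerA mulrC -scalerA; congr (_ *: _).
rewrite scaler_sumr (reindex_inj (perm_inj (s := tperm u v))) /=.
have tB z : (tperm u v z \in B) = (z \in B).
  by case: tpermP => // ->; rewrite ?Bu ?Bv.
under eq_bigl do rewrite tB.
apply: eq_bigr => z Bz; rewrite -transM.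
have -> : (tperm (tperm u v z) y * tperm u v = tperm u v * tperm z y)%g.
  rewrite conjgC tpermJ tpermK; congr (_ * tperm _ _)%g.
  by rewrite tpermD //; [apply: contraNneq By => <-|apply: contraNneq By => <-].
by rewrite transM fB // linearZ.
Qed.
End Invariant.

(** * Blocks of maximal size and the overlap inequality *)

Section MaximalBlock.
Variable T : finType.
Notation Sn := {perm T}.
Notation fn := {ffun Sn -> algC^o}.
Implicit Types (f h w : fn) (g s : Sn) (a : algC) (b : bool) (A B U : {set T}) (V : fn -> Prop).

(** Stability is asked only for Sym([U]), because [U] shrinks when a chain of blocks is built. *)
Record closed_under U V : Prop := ClosedUnder {
  closedD : forall f h, V f -> V h -> V (f + h);
  closedZ : forall a f, V f -> V (a *: f);
  closedT : forall x y f, x \in U -> y \in U -> V f -> V (trans (tperm x y) f) }.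

Lemma closed_spread U V b B y f : closed_under U V -> B \subset U -> y \in U ->
  V f -> V (spread b B y f).
Proof.
move=> cV /subsetP sBU Uy Vf.
have V0 : V 0 by rewrite -(scale0r f); apply: closedZ cV _ _ _.
apply: (closedD cV) => //; apply: (closedZ cV); apply: big_ind => // [|z Bz].
  exact: closedD cV.
by apply: (closedT cV) => //; apply: sBU.
Qed.

Definition maximal_block U V b B :=
  forall A f, A \subset U -> V f -> invar b A f -> f != 0 -> (#|A| <= #|B|)%N.

Lemma maximal_block_exists U V b f : V f -> f != 0 ->
  exists B h, [/\ B \subset U, V h, invar b B h, h != 0 & maximal_block U V b B].
Proof.
move=> Vf f0.
pose P B := `[< B \subset U /\ exists h, [/\ V h, invar b B h & h != 0] >].
have P0 : P set0.
  by apply/asboolP; split; [exact: sub0set|exists f; split=> // x y; rewrite inE].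
case: (arg_maxnP (fun B : {set T} => #|B|) P0) => B /asboolP[sBU [h [Vh hB h0]]] Bmax.
exists B, h; split=> // A u sAU Vu uA u0; apply: Bmax; apply/asboolP.
by split=> //; exists u.
Qed.

(** A nonzero [spread] would be a vector adapted to the larger block [y |: B]. *)
Lemma spread_eq0 U V b B y f : closed_under U V -> B \subset U -> V f -> invar b B f ->
  maximal_block U V b B -> y \in U -> y \notin B -> spread b B y f = 0.
Proof.
move=> cV sBU Vf fB Bmax Uy By; apply/eqP/negPn/negP => s0.
have := Bmax (y |: B) _ _ (closed_spread b cV sBU Uy Vf) (invar_spread By fB) s0.
rewrite cardsU1 By ltnn subUset sub1set Uy sBU => /(_ isT); done.
Qed.

Lemma dot_spread b A y f h : y \notin A -> invar b (y |: A) h ->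
  dot (spread b A y f) h = #|A|.+1%:R * dot f h.
Proof.
move=> Ay hA; rewrite dotDl dotZl dot_suml.
under eq_bigr => z Az.
  rewrite dot_transl tpermV hA ?setU11 ?setU1r //; last by apply: contraNneq Ay => <-.
  rewrite dotZr rmorph_sign; over.
by rewrite sumr_const mulrnAr mulrA -signr_addb addbb mul1r mulr_natl mulrS.
Qed.

(** [tperm z z'] preserves [dot], multiplies [f] by the same sign on both sides, and conjugates
    [tperm z y] into [tperm z' y]. *)
Lemma dot_transpose_const b B y f z z' : z \in B -> z' \in B -> y \notin B -> invar b B f ->
  dot f (trans (tperm z y) f) = dot f (trans (tperm z' y) f).
Proof.
move=> Bz Bz' By fB; have [->//|ne] := eqVneq z z'.
rewrite -[LHS](dot_trans (tperm z z')) -transM.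
have -> : (tperm z y * tperm z z' = tperm z z' * tperm z' y)%g.
  rewrite conjgC tpermJ tpermL tpermD //.
    by apply: contraNneq By => <-.
  by apply: contraNneq By => <-.
by rewrite transM fB // linearZ dotZl dotZr rmorph_sign mulrA -signr_addb addbb mul1r.
Qed.

(* Pick [y] in [g B] outside [B]: [trans g f] is invariant under the block
   [y |: (B :&: g B)], and symmetrising [f] over that block costs a factor
   [#|B :&: g B| + 1] in the squared norm because adding [y] to [B] kills [f]. *)
Lemma overlap_bound b B f g : invar b B f ->
  (forall y, y \notin B -> spread b B y f = 0) -> g @: B != B ->
  #|B :&: g @: B|.+1%:R * `|dot f (trans g f)| ^+ 2 <= dot f f ^+ 2.
Proof.
move=> fB sp0 gB.
have [y gBy By] : exists2 y, y \in g @: B & y \notin B.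
  apply/subsetPn; apply: contra gB => sgB.
  by rewrite eqEcard sgB card_imset ?leqnn //; apply: perm_inj.
set A := B :&: g @: B; set h := trans g f.
have Ay : y \notin A by rewrite inE (negPf By).
have hgB : invar b (y |: A) h.
  have sA : y |: A \subset g @: B by rewrite subUset sub1set gBy subsetIr.
  exact: (invarS sA (invar_trans fB)).
have fA : invar b A f by exact: (invarS (subsetIl _ _) fB).
pose F := spread b A y f.
have FA : invar b (y |: A) F by exact: (invar_spread Ay fA).
have dFh := dot_spread f Ay hgB; have dFF := dot_spread f Ay FA.
(* Since [spread b B y f] vanishes, the #|[B]| equal signed products of [f] with its transposes add
   up to [- dot f f]. Each is thus nonpositive, and [dot f F] adds only such terms to [dot f f]. *)
have dfF : dot f F <= dot f f.
  rewrite /F dotDr dotZr rmorph_sign dot_sumr -lerBrDl subrr.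
  have [->|[z0 Az0]] := set_0Vmem A; first by rewrite big_set0 mulr0.
  have Bz0 : z0 \in B by move: Az0; rewrite inE => /andP[].
  have := congr1 (dot f) (sp0 y By).
  rewrite dot0r dotDr dotZr rmorph_sign dot_sumr.
  set c := dot f (trans (tperm z0 y) f).
  under eq_bigr => z Bz do rewrite (dot_transpose_const Bz Bz0 By fB) -/c.
  under [in X in _ -> X]eq_bigr => z Az.
    rewrite (dot_transpose_const (z' := z0) _ _ By fB) //; last by case/setIP: Az.
    over.
  rewrite !sumr_const -/c => /eqP; rewrite addr_eq0 => /eqP e.
  have e' : (-1) ^+ b * c *+ #|B| = - dot f f by rewrite e opprK mulrnAr.
  have cle : (-1) ^+ b * c <= 0.
    rewrite -(@pmulrn_lle0 _ _ #|B|) ?e' ?oppr_le0 ?dot_ge0 //.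
    by rewrite card_gt0; apply/set0Pn; exists z0.
  by rewrite mulrnAr mulrn_wle0.
(* Both [dot F h] and [dot F F] carry a factor #|[A]| + 1, squared on the left and single on the
   right, so one factor survives. *)
have := dot_CauchySchwarz F h; rewrite dFh dFF dot_trans normrM normr_nat exprMn.
rewrite -mulrA expr2 -mulrA ler_pM2l ?ltr0n // => /le_trans; apply.
by rewrite expr2 ler_wpM2r // dot_ge0.
Qed.
End MaximalBlock.

(** * Random conjugates *)

Section Isotypic.
Variable T : finType.
Notation Sn := {perm T}.
Notation fn := {ffun Sn -> algC^o}.
Implicit Types (f h w : fn) (g s : Sn) (a : algC) (b : bool) (A B U : {set T}) (V : fn -> Prop).

(** The second field is the only consequence of Schur's lemma that the block arguments need: class
    sums act as scalars, and [r] is the normalised character. *)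
Record isotypic V (r : Sn -> algC) : Prop := Isotypic {
  isotypic_closed : closed_under [set: T] V;
  isotypic_avg : forall g f, V f ->
    \sum_s trans (g ^ s)%g f = (#|Sn|%:R * r g) *: f }.

Lemma card_Sn_gt0 : (0 < #|Sn|)%N.
Proof. by apply/card_gt0P; exists 1%g. Qed.

(** Pairing the averaging identity with [f] expresses [r g] as a mean of matrix coefficients. The
    weights are rational so that they can be estimated in a totally ordered field. *)
Lemma avg_bound V r f g (w : Sn -> rat) : isotypic V r -> V f -> f != 0 ->
  (forall s, `|dot f (trans (g ^ s)%g f)| <= ratr (w s) * dot f f) ->
  `|r g| <= ratr ((\sum_s w s) / #|Sn|%:R).
Proof.
move=> iV Vf f0 bw; have D0 := dot_gt0 f0.
have N0 : 0 < #|Sn|%:R :> algC by rewrite ltr0n card_Sn_gt0.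
have := congr1 (dot f) (isotypic_avg iV g Vf).
rewrite dot_sumr dotZr => /(congr1 Num.norm).
rewrite normrM norm_conjC normrM normr_nat (ger0_norm (dot_ge0 f)) => e.
have : `|\sum_s dot f (trans (g ^ s)%g f)| <= \sum_s ratr (w s) * dot f f.
  by apply: le_trans (ler_norm_sum _ _ _) _; apply: ler_sum.
rewrite e -mulr_suml ler_pM2r // fmorph_div /= ratr_nat rmorph_sum /=.
by rewrite ler_pdivlMr // mulrC.
Qed.
End Isotypic.

(** * Moments of a uniformly random permutation *)

Section RandomSlots.
Variable T : finType.
Notation Sn := {perm T}.
Notation N := #|{perm T}|.
Implicit Types (s g : Sn) (B D Z Q : {set T}).

(** Multiplying [s] by [tperm x x'] is a bijection of the permutations that gives [x] the image of
    [x'], so all slots outside [Z] are exchangeable. *)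
Lemma slot_sum (Z : {set T}) (x : T) (F : Sn -> T -> rat) : x \notin Z ->
  (forall x' s y, x' \notin Z -> F (tperm x x' * s)%g y = F s y) ->
  #|~: Z|%:R * \sum_s F s (s x) = \sum_s \sum_(x' in ~: Z) F s (s x').
Proof.
move=> Zx HF; rewrite exchange_big /= mulr_natl -sumr_const.
apply: eq_bigr => x'; rewrite inE => Zx'.
rewrite (reindex_inj (mulgI (tperm x x'))) /=; apply: eq_bigr => s _.
by rewrite HF // permM tpermL.
Qed.

Lemma card_preim_perm s Q : #|[set x | s x \in Q]| = #|Q|.
Proof.
rewrite -[in RHS](card_imset Q (@perm_inj _ s^-1%g)); apply: eq_card => x.
rewrite inE; apply/idP/imsetP => [Qx|[y Qy ->]]; last by rewrite permKV.
by exists (s x); rewrite ?permK.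
Qed.

Lemma sum_indicator (P : pred T) Q : \sum_(x in Q) (P x)%:R = #|[set x in Q | P x]|%:R :> rat.
Proof.
rewrite -sum1_card natr_sum [LHS]big_mkcond [RHS]big_mkcond /=.
by apply: eq_bigr => x _; rewrite inE; case: (x \in Q); case: (P x).
Qed.

(** Where [R s] is nonzero no point of [Z] lands in [Q], so all #|[Q]| preimages of [Q] are among
    the free slots and the count is exact. *)
Lemma slot_eq Z x Q (R : Sn -> rat) : x \notin Z ->
  (forall x' s, x' \notin Z -> R (tperm x x' * s)%g = R s) ->
  (forall s z, z \in Z -> s z \in Q -> R s = 0) ->
  #|~: Z|%:R * \sum_(s : Sn) (s x \in Q)%:R * R s = #|Q|%:R * \sum_s R s.
Proof.
move=> Zx HR HZ; rewrite (slot_sum (F := fun s y => (y \in Q)%:R * R s)) //; last first.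
  by move=> x' s y Zx'; rewrite HR.
rewrite mulr_sumr; apply: eq_bigr => s _; rewrite -mulr_suml.
have [->|R0] := eqVneq (R s) 0; first by rewrite !mulr0.
congr (_ * _); rewrite (sum_indicator (fun y => s y \in Q)); congr _%:R.
have key y : s y \in Q -> y \notin Z.
  by move=> sy; apply: contraNN R0 => Zy; rewrite (HZ _ _ Zy sy).
rewrite -[RHS](card_preim_perm s); apply: eq_card => y; rewrite !inE.
by apply/andP/idP => [[]//|sy]; rewrite key.
Qed.

Lemma slot_le Z x Q (R : Sn -> rat) : x \notin Z ->
  (forall s, 0 <= R s) ->
  (forall x' s, x' \notin Z -> R (tperm x x' * s)%g = R s) ->
  #|~: Z|%:R * \sum_(s : Sn) (s x \in Q)%:R * R s <= #|Q|%:R * \sum_s R s.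
Proof.
move=> Zx R0 HR; rewrite (slot_sum (F := fun s y => (y \in Q)%:R * R s)) //; last first.
  by move=> x' s y Zx'; rewrite HR.
rewrite mulr_sumr; apply: ler_sum => s _; rewrite -mulr_suml ler_wpM2r //.
rewrite (sum_indicator (fun y => s y \in Q)) ler_nat -[X in (_ <= X)%N](card_preim_perm s).
by apply: subset_leq_card; apply/subsetP => y; rewrite !inE => /andP[].
Qed.

Lemma sum1_perm : \sum_(s : Sn) (1 : rat) = N%:R.
Proof. by rewrite sumr_const. Qed.

Definition cross B x y s : rat := (s x \in ~: B)%:R * (s y \in B)%:R.

Lemma cross_mean B x y : x != y ->
  (#|T|%:R * #|T|.-1%:R) * (\sum_s cross B x y s) = #|~: B|%:R * #|B|%:R * N%:R.
Proof.
move=> xy; rewrite -mulrA.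
have := @slot_eq [set y] x (~: B) (fun s => (s y \in B)%:R).
rewrite cardsC1 => -> //; last 3 first.
- by rewrite inE.
- by move=> x' s; rewrite inE => x'y; rewrite permM tpermD.
- by move=> s z; rewrite !inE => /eqP-> /negPf->.
rewrite mulrCA; have := @slot_eq set0 y B (fun => 1).
rewrite setC0 cardsT sum1_perm => e; rewrite -mulrA -e ?inE //; first last.
- by move=> s z; rewrite inE.
by congr (_ * (_ * _)); apply: eq_bigr => s _; rewrite mulr1.
Qed.

(** The images are revealed one at a time. Only an inequality results, since revealed images may
    already occupy places in [B] or its complement. *)
Lemma cross_pair B x y x' y' : uniq [:: x; y; x'; y'] ->
  (#|T|%:R * (#|T| - 1)%:R * (#|T| - 2)%:R * (#|T| - 3)%:R) *
  (\sum_s cross B x y s * cross B x' y' s) <= (#|~: B|%:R * #|B|%:R) ^+ 2 * N%:R.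
Proof.
rewrite /= !inE !negb_or => /andP[/and3P[xy xx' xy'] /andP[/andP[yx' yy'] /andP[x'y' _]]].
have cC3 : #|~: [set y; x'; y']| = (#|T| - 3)%N.
  by rewrite cardsCs setCK -setUA cardsU1 cards2 !inE negb_or yx' yy' x'y'.
have cC2 : #|~: [set x'; y']| = (#|T| - 2)%N by rewrite cardsCs setCK cards2 x'y'.
have h1 := @slot_le [set y; x'; y'] x (~: B)
  (fun s => (s y \in B)%:R * ((s x' \in ~: B)%:R * (s y' \in B)%:R)).
have h2 := @slot_le [set x'; y'] y B (fun s => (s x' \in ~: B)%:R * (s y' \in B)%:R).
have h3 := cross_mean B x'y'.
rewrite cC3 in h1; rewrite cC2 in h2; rewrite -subn1 in h3.
have e : \sum_s cross B x y s * cross B x' y' s =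
  \sum_(s : Sn) (s x \in ~: B)%:R * ((s y \in B)%:R * ((s x' \in ~: B)%:R * (s y' \in B)%:R)).
  by apply: eq_bigr => s _; rewrite /cross !mulrA.
rewrite e; apply: (@le_trans _ _ (#|T|%:R * (#|T| - 1)%:R * (#|T| - 2)%:R *
   (#|~: B|%:R * \sum_(s : Sn) (s y \in B)%:R * ((s x' \in ~: B)%:R * (s y' \in B)%:R)))).
  rewrite -mulrA ler_wpM2l ?mulr_ge0 ?ler0n //; apply: h1.
  - by rewrite !inE !negb_or xy xx' xy'.
  - by move=> s; rewrite !mulr_ge0 ?ler0n.
  - move=> z s; rewrite !inE !negb_or => /andP[/andP[zy zx'] zy'].
    by rewrite !permM !tpermD.
have : (#|T| - 2)%:R * (\sum_(s : Sn) (s y \in B)%:R * ((s x' \in ~: B)%:R * (s y' \in B)%:R))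
   <= #|B|%:R * (\sum_s cross B x' y' s).
  apply: h2; first by rewrite !inE negb_or yx' yy'.
    by move=> s; rewrite !mulr_ge0 ?ler0n.
  by move=> z s; rewrite !inE !negb_or => /andP[zx' zy']; rewrite !permM !tpermD.
set S2 := \sum_(s : Sn) (s y \in B)%:R * _; set S3 := (\sum_s cross B x' y' s) in h3 *.
move: (#|T| - 2)%N (#|T| - 1)%N h3 => n2 n1 h3 h.
have -> : (#|~: B|%:R * #|B|%:R) ^+ 2 * N%:R = #|~: B|%:R * #|B|%:R * (#|T|%:R * n1%:R * S3) :> rat.
  by rewrite h3; ring.
have -> : #|T|%:R * n1%:R * n2%:R * (#|~: B|%:R * S2) =
  (#|~: B|%:R * #|T|%:R * n1%:R) * (n2%:R * S2) by ring.
have -> : #|~: B|%:R * #|B|%:R * (#|T|%:R * n1%:R * S3) =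
  (#|~: B|%:R * #|T|%:R * n1%:R) * (#|B|%:R * S3) by ring.
by rewrite ler_wpM2l // !mulr_ge0 ?ler0n.
Qed.
End RandomSlots.

(** * The probability that a random conjugate preserves a block *)

Section SplitProbability.
Variable T : finType.
Notation Sn := {perm T}.
Notation N := #|{perm T}|.
Implicit Types (g s : Sn) (B D : {set T}).

Definition fix_prob g B : rat := #|[set s : Sn | (g ^ s)%g @: B == B]|%:R / N%:R.
Definition cross_prob B : rat := (#|~: B|%:R * #|B|%:R) / (#|T|%:R * (#|T| - 1)%:R).
Definition cross_prob2 B : rat := (#|~: B|%:R * #|B|%:R) ^+ 2 /
  (#|T|%:R * (#|T| - 1)%:R * (#|T| - 2)%:R * (#|T| - 3)%:R).

(* Second moment method for the number of [x] in [D] such that [g ^ s] maps the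
   point [s x] outside [B] into [B]. *)
Lemma fix_prob_le g B D (lam : rat) : (3 < #|T|)%N -> (forall x, x \in D -> g x \notin D) ->
  fix_prob g B <= 1 - 2 * lam * (#|D|%:R * cross_prob B)
    + lam ^+ 2 * (#|D|%:R * cross_prob B + #|D|%:R ^+ 2 * cross_prob2 B).
Proof.
move=> nT Dg; have N0 : 0 < N%:R :> rat by rewrite ltr0n card_Sn_gt0.
have ne x : x \in D -> x != g x by move=> Dx; apply: contraNneq (Dg x Dx) => <-.
pose X s : rat := \sum_(x in D) cross B x (g x) s.
have [n0 n1 n2 n3] : [/\ 0 < #|T|%:R :> rat, 0 < (#|T| - 1)%:R :> rat,
  0 < (#|T| - 2)%:R :> rat & 0 < (#|T| - 3)%:R :> rat] by rewrite !ltr0n; split; lia.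
have p1 x : x \in D -> \sum_s cross B x (g x) s = cross_prob B * N%:R.
  move=> Dx; have := cross_mean B (ne x Dx); rewrite -subn1 /cross_prob => e.
  rewrite mulrAC -e mulrC mulKf // mulf_neq0 //; exact: lt0r_neq0.
(* As [D] is disjoint from its image under [g], the points [x], [g x], [x'], [g x'] are distinct. *)
have p2 x x' : x \in D -> x' \in D -> x != x' ->
    \sum_s cross B x (g x) s * cross B x' (g x') s <= cross_prob2 B * N%:R.
  move=> Dx Dx' xx'; rewrite /cross_prob2 mulrAC ler_pdivlMr ?mulr_gt0 // mulrC.
  apply: cross_pair; rewrite /= !inE !negb_or ne // ne // xx' (inj_eq perm_inj) xx' /=.
  rewrite (contraNneq _ (Dg x' Dx')) => [|<-] //.
  by rewrite (contraNneq _ (Dg x Dx)) => [|->].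
have sX : \sum_s X s = #|D|%:R * cross_prob B * N%:R.
  rewrite /X exchange_big /= (eq_bigr (fun=> cross_prob B * N%:R)) // sumr_const.
  by rewrite -[LHS]mulr_natl mulrA.
have P2 : 0 <= cross_prob2 B by rewrite divr_ge0 ?sqr_ge0 ?mulr_ge0 // ltW.
have sX2 : \sum_s X s ^+ 2 <= (#|D|%:R * cross_prob B + #|D|%:R ^+ 2 * cross_prob2 B) * N%:R.
  have -> : \sum_s X s ^+ 2 =
      \sum_(x in D) \sum_(x' in D) \sum_s cross B x (g x) s * cross B x' (g x') s.
    under eq_bigr => s _ do rewrite expr2 /X mulr_suml.
    rewrite exchange_big; apply: eq_bigr => x _ /=.
    by under eq_bigr => s _ do rewrite mulr_sumr; rewrite exchange_big.
  have -> : (#|D|%:R * cross_prob B + #|D|%:R ^+ 2 * cross_prob2 B) * N%:R =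
     \sum_(x in D) (cross_prob B * N%:R + #|D|%:R * (cross_prob2 B * N%:R)).
    by rewrite sumr_const -[RHS]mulr_natl; ring.
  apply: ler_sum => x Dx; rewrite (bigD1 x) //=; apply: lerD.
    rewrite -(p1 x Dx); apply: ler_sum => s _; rewrite /cross.
    by case: (_ \in ~: B); case: (_ \in B); rewrite ?(mul0r, mulr0, mulr1).
  apply: (@le_trans _ _ (\sum_(x' in D | x' != x) (cross_prob2 B * N%:R))).
    by apply: ler_sum => x' /andP[Dx' x'x]; apply: p2 => //; rewrite eq_sym.
  rewrite sumr_const -[X in X <= _]mulr_natl ler_wpM2r //.
    by rewrite mulr_ge0 // ltW.
  by rewrite ler_nat; apply: subset_leq_card; apply/subsetP => y /andP[].
have XB s : (g ^ s)%g @: B == B -> X s = 0.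
  move=> /eqP gB; rewrite /X big1 // => x Dx; rewrite /cross inE.
  case sx : (s x \in B) => /=; rewrite ?mul0r // mul1r.
  case sgx: (s (g x) \in B) => //; move: sgx; rewrite -{1}gB.
  have -> : s (g x) = (g ^ s)%g (s x) by rewrite conjgE !permM permK.
  by rewrite mem_imset ?sx //; apply: perm_inj.
(* [X] vanishes when the conjugate preserves [B], so the indicator of that event is at most
   [(1 - lam * X s) ^+ 2] for every [lam]. *)
rewrite ler_pdivrMr //; apply: (@le_trans _ _ (\sum_s (1 - lam * X s) ^+ 2)).
  rewrite -sum1_card natr_sum big_mkcond /=; apply: ler_sum => s _.
  by rewrite inE; case: ifP => [/XB->|_]; rewrite ?sqr_ge0 // mulr0 subr0 expr1n.
have -> : \sum_s (1 - lam * X s) ^+ 2 =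
    N%:R - 2 * lam * (\sum_s X s) + lam ^+ 2 * (\sum_s X s ^+ 2).
  rewrite -(sum1_perm T) !mulr_sumr -sumrB -big_split /=; apply: eq_bigr => s _; ring.
rewrite sX [X in _ <= X](_ : _ = N%:R - 2 * lam * (#|D|%:R * cross_prob B * N%:R) +
  lam ^+ 2 * ((#|D|%:R * cross_prob B + #|D|%:R ^+ 2 * cross_prob2 B) * N%:R)); last by ring.
by rewrite lerD2l ler_wpM2l ?sqr_ge0.
Qed.
End SplitProbability.

(** * Character bounds from one large block *)

Section BlockBounds.
Variable T : finType.
Notation Sn := {perm T}.
Notation N := #|{perm T}|.
Notation fn := {ffun Sn -> algC^o}.
Implicit Types (g s : Sn) (B D : {set T}) (V : fn -> Prop) (f : fn).

Definition moved g : {set T} := [set x | g x != x].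

(** For a maximal [D] disjoint from its image, every moved point lies in [D], its image or its
    preimage, as it could otherwise be added. So [D] has at least a third as many points as
    [moved g]. *)
Lemma separated_set g m : (3 * m <= #|moved g|)%N ->
  exists2 D : {set T}, #|D| = m & forall x, x \in D -> g x \notin D.
Proof.
move=> gm.
pose P (D : {set T}) := [forall x in D, g x \notin D].
have P0 : P set0 by apply/forall_inP => x; rewrite inE.
case: (arg_maxnP (fun D : {set T} => #|D|) P0) => D /forall_inP PD Dmax.
have sm : moved g \subset D :|: g @: D :|: g^-1%g @: D.
  apply/subsetP => x; rewrite inE => gx; apply: contraT.
  rewrite !inE !negb_or => /andP[/andP[Dx gDx] giDx].
  have gDx' : g x \notin D.
    by apply: contraNN giDx => h; apply/imsetP; exists (g x); rewrite ?permK.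
  suff /Dmax : P (x |: D) by rewrite /= cardsU1 Dx add1n ltnn.
  apply/forall_inP => y; rewrite !inE => /predU1P[->|Dy].
    by rewrite (negPf gx).
  rewrite negb_or PD // andbT; apply: contraNneq gDx => <-; exact: imset_f.
have cD : (m <= #|D|)%N.
  have := leq_trans gm (subset_leq_card sm).
  have := (leq_card_setU (D :|: g @: D) (g^-1%g @: D)).1.
  have := (leq_card_setU D (g @: D)).1.
  rewrite !card_imset; [lia|exact: perm_inj|exact: perm_inj].
exists [set x in take m (enum D)].
  rewrite cardsE; have /card_uniqP-> : uniq (take m (enum D)) by rewrite take_uniq ?enum_uniq.
  by rewrite size_takel // -cardE.
have sD x : x \in take m (enum D) -> x \in D by move/mem_take; rewrite mem_enum.
by move=> x; rewrite !inE => /sD/PD; apply: contraNN => /sD.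
Qed.

Lemma card_moved_conj g s : #|moved (g ^ s)%g| = #|moved g|.
Proof.
rewrite -(card_preim_perm s); apply: eq_card => x; rewrite !inE conjgE !permM permK.
by rewrite (inj_eq perm_inj).
Qed.

Lemma fix_prob_ge0 g B : 0 <= fix_prob g B.
Proof. by rewrite divr_ge0. Qed.

(** Conjugates that preserve [B] are estimated by 1, the others by 1/[q] through [overlap_bound]. *)
Lemma block_bound V r b B f g (q : nat) : isotypic V r -> V f -> f != 0 -> invar b B f ->
  (forall y, y \notin B -> spread b B y f = 0) -> (0 < q)%N ->
  (forall s, (q ^ 2 <= #|B :&: (g ^ s)%g @: B|.+1)%N) ->
  `|r g| <= ratr (fix_prob g B + (1 - fix_prob g B) / q%:R).
Proof.
move=> iV Vf f0 fB sp q0 qB.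
have N0 : 0 < N%:R :> rat by rewrite ltr0n card_Sn_gt0.
pose w s : rat := if (g ^ s)%g @: B == B then 1 else q%:R^-1.
have -> : fix_prob g B + (1 - fix_prob g B) / q%:R = (\sum_s w s) / N%:R.
  rewrite (bigID (fun s => (g ^ s)%g @: B == B)) /=.
  rewrite (eq_bigr (fun=> 1)) => [|s e]; last by rewrite /w e.
  rewrite [X in _ = (_ + X) / _](eq_bigr (fun=> q%:R^-1)) => [|s e]; last by rewrite /w (negPf e).
  rewrite !sumr_const /fix_prob -(cardC [pred s | (g ^ s)%g @: B == B]) natrD.
  rewrite cardsE -mulr_natr; set a := #|_|%:R; set c := #|_|%:R.
  have : a + c != 0.
    by rewrite /a /c -natrD (cardC [pred s | (g ^ s)%g @: B == B]) lt0r_neq0.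
  have : q%:R != 0 :> rat by rewrite pnatr_eq0 -lt0n.
  by move=> ? ?; field; apply/andP.
apply: (avg_bound iV Vf f0) => s; rewrite /w; case: ifP => [_|/negbT nB].
  by rewrite rmorph1 mul1r -{1}(trans1 f) dot_trans_le.
have := overlap_bound fB sp nB; set m := #|_|.+1 => h.
rewrite fmorphV /= ratr_nat mulrC ler_pdivlMr ?ltr0n //.
rewrite -(@ler_pXn2r _ 2) ?nnegrE ?mulr_ge0 ?dot_ge0 // exprMn mulrC.
apply: le_trans h; rewrite ler_wpM2r ?exprn_ge0 //.
by rewrite -natrX ler_nat qB.
Qed.

Lemma card_overlap_moved g B : (#|B| <= #|B :&: g @: B| + #|moved g|)%N.
Proof.
rewrite -(cardsID (g @: B) B) leq_add2l; apply: subset_leq_card.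
apply/subsetP => x; rewrite !inE => /andP[gB Bx]; apply: contraNneq gB => e.
by apply/imsetP; exists x.
Qed.

Lemma card_overlap_compl g B : (#|B| <= #|B :&: g @: B| + #|~: B|)%N.
Proof.
have -> : #|B| = #|g @: B| by rewrite card_imset //; apply: perm_inj.
rewrite -(cardsID B (g @: B)) setIC leq_add2l; apply: subset_leq_card.
by apply/subsetP => x; rewrite !inE => /andP[].
Qed.

(** Thirty moved points give ten separated ones. The small complement forces an overlap of at least
    190 points, more than the 10^2 needed for [q] = 10. *)
Lemma near_trivial_bound V r b B f g : isotypic V r -> V f -> f != 0 -> invar b B f ->
  (forall y, y \notin B -> spread b B y f = 0) ->
  (200 <= #|T|)%N -> (40 * #|~: B| <= #|T|)%N -> (30 <= #|moved g|)%N ->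
  `|r g| <= ratr (1 - 4 * #|~: B|%:R / #|T|%:R).
Proof.
move=> iV Vf f0 fB sp nT jn gm.
have [D cD Dg] := @separated_set g 10 gm.
have cB := cardsC B.
apply: le_trans (@block_bound V r b B f g 10 iV Vf f0 fB sp isT _) _.
  by move=> s; have := card_overlap_compl (g ^ s)%g B; lia.
rewrite ler_rat; apply: (near_trivial_arith (b := #|B|%:R)).
- by rewrite -natrD cB.
- exact: ler0n.
- by rewrite -natrM ler_nat.
- by rewrite ler_nat.
have := @fix_prob_le T g B D (1 / 2) _ Dg; rewrite cD => /(_ ltac:(lia)).
rewrite /cross_prob /cross_prob2 !natrB //; by [lia|].
Qed.

(** The complement of [B] may be large here, so the overlap is controlled by the support of [g]
    instead. *)
Lemma mid_bound V r b B f g (m q W : nat) : isotypic V r -> V f -> f != 0 -> invar b B f ->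
  (forall y, y \notin B -> spread b B y f = 0) ->
  (200 <= #|T|)%N -> (#|T| <= 40 * #|~: B|)%N -> (#|T| <= W * #|B|)%N ->
  (0 < m)%N -> (0 < q)%N -> (0 < W)%N ->
  (3 * m <= #|moved g|)%N -> (q ^ 2 + #|moved g| <= #|B|.+1)%N ->
  `|r g| <= ratr (40 * W%:R / m%:R + 8 / #|T|%:R + 1 / q%:R).
Proof.
move=> iV Vf f0 fB sp nT jn bn m0 q0 W0 gm gB.
have [D cD Dg] := separated_set gm.
have cB := cardsC B.
apply: le_trans (@block_bound V r b B f g q iV Vf f0 fB sp q0 _) _.
  by move=> s; have := card_overlap_moved (g ^ s)%g B; rewrite card_moved_conj; lia.
rewrite ler_rat; apply: lerD; last first.
  by rewrite ler_wpM2r ?invr_ge0 ?ler0n // gerBl fix_prob_ge0.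
apply: (mid_arith (b := #|B|%:R) (j := #|~: B|%:R)).
- by rewrite -natrD cB.
- by rewrite ler_nat.
- by rewrite ler1n.
- by rewrite -natrM ler_nat.
- by rewrite -natrM ler_nat.
- by rewrite ltr0n.
have := @fix_prob_le T g B D (m%:R * cross_prob B)^-1 _ Dg; rewrite cD => /(_ ltac:(lia)).
rewrite /cross_prob /cross_prob2 !natrB //; by [lia|].
Qed.
End BlockBounds.

(** * Vectors adapted to a chain of blocks *)

Section YoungVectors.
Variable T : finType.
Notation Sn := {perm T}.
Notation N := #|{perm T}|.
Notation fn := {ffun Sn -> algC^o}.
Implicit Types (g k s : Sn) (B D U : {set T}) (V : fn -> Prop) (f h : fn) (c : T -> nat).

(** [c] labels the blocks in the order of their choice. The second clause says that enlarging a
    block by a point of a later one kills [h]. *)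
Definition young U h c : Prop :=
  (forall x y, x \in U -> y \in U -> c x = c y -> x != y -> trans (tperm x y) h = h) /\
  (forall x y, x \in U -> y \in U -> (c x < c y)%N ->
     \sum_(z in U | c z == c x) trans (tperm z y) h = - h).

(* The blocks are chosen greedily, each of maximal size given the previous ones. *)
Lemma young_exists U V f : closed_under U V -> V f -> f != 0 ->
  exists h c, [/\ V h, h != 0 & young U h c].
Proof.
have [m] := ubnP #|U|; elim: m => // m IHm in U V f *; rewrite ltnS => Um cV Vf f0.
have [U0|[x0 Ux0]] := set_0Vmem U.
  by exists f, (fun=> 0%N); split=> //; split=> x y; rewrite U0 inE.
have [B [h [sBU Vh hB h0 Bmax]]] := maximal_block_exists U false Vf f0.
have B0 : (0 < #|B|)%N.
  have := Bmax [set x0] h; rewrite cards1; apply=> //; first by rewrite sub1set.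
  by move=> x y /set1P-> /set1P->; rewrite eqxx.
(* Later choices are made among vectors adapted to [B], a subspace on which Sym([U :\: B]) still
   acts. *)
pose V' u := V u /\ invar false B u.
have cV' : closed_under (U :\: B) V'.
  split.
  - by move=> u v [Vu uB] [Vv vB]; split; [exact: closedD cV _ _ Vu Vv|exact: invarD].
  - by move=> a u [Vu uB]; split; [exact: closedZ cV _ _ Vu|exact: invarZ].
  move=> x y u; rewrite !inE => /andP[Bx Ux] /andP[By Uy] [Vu uB]; split.
    exact: closedT cV _ _ _ Ux Uy Vu.
  have <- : tperm x y @: B = B; last exact: invar_trans.
  rewrite -[RHS](imset_id B); apply: eq_in_imset => z Bz.
  by rewrite tpermD //; [apply: contraNneq Bx => ->|apply: contraNneq By => ->].
have [|u [c [[Vu uB] u0 [same less]]]] := IHm (U :\: B) V' h _ cV' (conj Vh hB) h0.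
  apply: leq_trans Um; rewrite -(cardsID B U) (setIidPr sBU) -add1n leq_add2r //.
(* The new block takes label 0 and the labels from the recursion are shifted up. *)
exists u, (fun x => if x \in B then 0%N else (c x).+1); split=> //; split=> x y Ux Uy.
  case: ifP => Bx; case: ifP => By // e xy; first by rewrite uB // expr0 scale1r.
  by apply: same => //; [rewrite inE Bx|rewrite inE By|case: e].
case: ifP => Bx; case: ifP => By // lt.
  have := spread_eq0 cV sBU Vu uB Bmax Uy (negbT By).
  rewrite /spread expr0 scale1r => /eqP; rewrite addrC addr_eq0 => /eqP <-.
  apply: eq_bigl => z; case Bz : (z \in B); last by rewrite andbF.
  by rewrite andbT (subsetP sBU).
rewrite -(less x y) ?inE ?Bx ?By //.
by apply: eq_bigl => z; rewrite inE; case Bz : (z \in B); rewrite ?andbF //= andbC eqSS.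
Qed.

Definition block c x : {set T} := [set z | c z == c x].

Lemma block_gt0 c x : (0 < #|block c x|)%N.
Proof. by apply/card_gt0P; exists x; rewrite inE. Qed.

Lemma young_same h c x y : young setT h c -> c x = c y -> trans (tperm x y) h = h.
Proof.
case=> same _ e; have [->|ne] := eqVneq x y; first by rewrite tperm1 trans1.
exact: same.
Qed.

Lemma young_less h c x y : young setT h c -> (c x < c y)%N ->
  \sum_(z in block c x) trans (tperm z y) h = - h.
Proof.
case=> _ less lt; rewrite -(less x y) //; apply: eq_bigl => z; by rewrite !inE.
Qed.

Lemma young_invar h c x : young setT h c -> invar false (block c x) h.
Proof.
move=> Yh y z; rewrite !inE => /eqP ey /eqP ez _.
by rewrite expr0 scale1r (young_same Yh) // ey ez.
Qed.

(* [tperm z z'] fixes [h] and [u], so [tperm z y] may be averaged over the block of [z]. *)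
Lemma young_dot h c u z y : young setT h c -> (c z < c y)%N ->
  (forall z', c z' = c z -> trans (tperm z z') u = u) ->
  #|block c z|%:R * dot (trans (tperm z y) h) u = - dot h u.
Proof.
move=> Yh zy uz; rewrite -dotNl -(young_less Yh zy) dot_suml mulr_natl -sumr_const.
apply: eq_bigr => z'; rewrite inE => /eqP ez.
rewrite -[LHS](dot_trans (tperm z z')) uz // -transM.
have [->|ne] := eqVneq z z'; first by rewrite tperm1 mulg1.
have yz : y != z by apply: contraTneq zy => ->; rewrite ltnn.
have yz' : y != z' by apply: contraTneq zy => ->; rewrite ez ltnn.
rewrite conjgC tpermJ tpermL tpermD 1?eq_sym // transM (young_same Yh) //.
Qed.

(** Write [k] as [k'] times [tperm z (k z)]. Then [k'] fixes the whole block of [z], so [young_dot]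
    applies to [trans k' h] and gains the size of that block. *)
Lemma young_bound h c k z : young setT h c -> z \in moved k ->
  (forall w, w \in moved k -> w != z -> (c z < c w)%N) ->
  #|block c z|%:R * `|dot h (trans k h)| <= dot h h.
Proof.
move=> Yh kz lt; rewrite inE in kz.
set y := k z in kz; pose k' := (k * tperm z y)%g.
have ek : k = (k' * tperm z y)%g by rewrite /k' -mulgA tperm2 mulg1.
have ky : y \in moved k by rewrite inE /y (inj_eq perm_inj).
have k'z : k' z = z by rewrite permM tpermR.
have cy : (c z < c y)%N by apply: lt.
rewrite {1}ek transM -{1}(tpermV z y) -dot_transl.
have := young_dot (u := trans k' h) Yh cy _ => H.
rewrite -normr_nat -normrM H ?normrN.
  by rewrite -{1}(trans1 h) dot_trans_le.
move=> z' ez; have [<-|ne] := eqVneq z z'; first by rewrite tperm1 trans1.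
have kz' : k z' = z'.
  apply/eqP; apply: contraT => kz'.
  by have := lt z'; rewrite inE kz' (eq_sym z') ne ez ltnn => /(_ isT isT).
have k'z' : k' z' = z'.
  rewrite permM kz' tpermD //; apply: contraTneq cy => ->; by rewrite ez ltnn.
rewrite -transM.
have -> : (k' * tperm z z' = tperm z z' * k')%g.
  by rewrite [RHS]conjgC tpermJ k'z k'z'.
by rewrite transM (young_same Yh).
Qed.
End YoungVectors.

(** * Averaging over conjugates when all blocks are small *)

Section ManyBlocks.
Variable T : finType.
Notation Sn := {perm T}.
Notation N := #|{perm T}|.
Notation fn := {ffun Sn -> algC^o}.
Implicit Types (g k s : Sn) (B D U : {set T}) (V : fn -> Prop) (f h : fn) (c : T -> nat).

(** The points are added from the last label to the first. By [young_dot] each new transposed term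
    has nonpositive product with [h] and enters with a minus sign, so [dot h u] never decreases and
    [u] cannot vanish when [h] does not. *)
Lemma transversal_antisymmetrize V h c (l : seq T) : closed_under setT V -> V h ->
  young setT h c -> pairwise (relpre c ltn) l ->
  exists u, [/\ V u, invar true [set x in l] u, dot h h <= dot h u &
    forall z z', c z = c z' -> all (fun y => c z < c y)%N l -> trans (tperm z z') u = u].
Proof.
move=> cV Vh Yh; elim: l => [_|x l IH].
  by exists h; split=> // [x y|z z' e _]; rewrite ?inE // (young_same Yh e).
rewrite pairwise_cons => /andP[/allP xl /IH[u [Vu uA hu uz]]].
have lx y : y \in l -> (c x < c y)%N by move/xl.
have xNl : x \notin [set y in l] by rewrite inE; apply/negP => /lx; rewrite ltnn.
exists (spread true [set y in l] x u); split.
- by apply: closed_spread cV _ _ Vu; rewrite ?subsetT ?inE.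
- by have := invar_spread xNl uA; congr invar; apply/setP => y; rewrite !inE.
- rewrite dotDr dotZr dot_sumr rmorphXn rmorphN1 expr1 mulN1r.
  apply: (le_trans hu); rewrite lerDl oppr_ge0; apply: sumr_le0 => y.
  rewrite inE => ly; have := young_dot (u := u) Yh (lx y ly) _ => H.
  rewrite -{1}(tpermV y x) tpermC -dot_transl.
  rewrite -(@pmulr_rle0 _ #|block c x|%:R) ?ltr0n ?block_gt0 // H.
    by rewrite oppr_le0 (le_trans (dot_ge0 h) hu).
  by move=> z' e; apply: uz; [rewrite e|apply/allP].
move=> z z' e /= /andP[zx /allP zl]; rewrite /spread linearD linearZ linear_sum /=.
rewrite uz //; last exact/allP.
congr (_ + _ *: _); apply: eq_bigr => y; rewrite inE => ly; rewrite -transM.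
have zy := zl y ly.
have ne (a b : T) : (c a < c b)%N -> a != b by move=> lt; apply: contraTneq lt => ->; rewrite ltnn.
have -> : (tperm y x * tperm z z' = tperm z z' * tperm y x)%g.
  by rewrite conjgC tpermJ !tpermD ?ne -?e.
by rewrite transM uz //; apply/allP.
Qed.

Definition block_rep c (x : T) : T := odflt x [pick z | c z == c x].

Lemma block_repE c x : c (block_rep c x) = c x.
Proof. by rewrite /block_rep; case: pickP => [z /eqP|]. Qed.

Lemma block_rep_eq c x y : c x = c y -> block_rep c x = block_rep c y.
Proof.
by rewrite /block_rep => e; rewrite e; case: pickP => //= /(_ y); rewrite eqxx.
Qed.

Definition reps c : {set T} := block_rep c @: setT.

Lemma sum_inv_block c : \sum_x (#|block c x|%:R)^-1 = #|reps c|%:R :> rat.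
Proof.
rewrite (partition_big (block_rep c) (mem (reps c))) /=; last first.
  by move=> x _; apply: imset_f.
rewrite -sum1_card natr_sum; apply: eq_bigr => _ /imsetP[x _ ->].
rewrite (eq_bigl (mem (block c x))); last first.
  move=> y; transitivity (y \in block c x) => //; rewrite inE.
  apply/eqP/eqP => [e|]; last exact: block_rep_eq.
  by rewrite -(block_repE c y) e block_repE.
rewrite (eq_bigr (fun=> (#|block c x|%:R)^-1)); last first.
  move=> y yB; have : y \in block c x by [].
  rewrite inE => /eqP e; congr (_%:R^-1); apply: eq_card => z.
  by rewrite !inE e.
by rewrite sumr_const -[LHS]mulr_natl mulfV // pnatr_eq0 -lt0n block_gt0.
Qed.

(** One point from each block, sorted by label, supports a nonzero alternating vector, so the number
    of blocks is at most the size of an alternating block. *)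
Lemma reps_bound V h c (m : nat) : closed_under setT V -> V h -> h != 0 -> young setT h c ->
  (forall B u, V u -> invar true B u -> u != 0 -> (#|B| <= m)%N) ->
  (#|reps c| <= m)%N.
Proof.
move=> cV Vh h0 Yh Hm.
pose l := sort (relpre c leq) (enum (reps c)).
have ml x : x \in l = (x \in reps c) by rewrite mem_sort mem_enum.
have cI : {in l &, injective c}.
  move=> x y; rewrite !ml => /imsetP[a _ ->] /imsetP[b _ ->]; rewrite !block_repE.
  exact: block_rep_eq.
have ul : uniq l by rewrite sort_uniq enum_uniq.
have pl : pairwise (relpre c ltn) l.
  have : sorted (relpre c leq) l by apply: sort_sorted => x y; apply: leq_total.
  rewrite sorted_pairwise; last by move=> ? ? ?; apply: leq_trans.
  elim: (l) ul cI => //= x r IH /andP[xr ur] cI /andP[/allP xle pr].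
  rewrite IH ?andbT //; last by move=> a b ra rb; apply: cI; rewrite inE ?ra ?rb orbT.
  apply/allP => y yr /=; have /= le_xy := xle _ yr.
  rewrite ltn_neqAle le_xy andbT; apply: contraNneq xr => e.
  by rewrite (cI x y) // inE ?eqxx ?yr ?orbT.
have [u [Vu uA hu _]] := transversal_antisymmetrize cV Vh Yh pl.
have u0 : u != 0.
  by apply: contraTneq hu => ->; rewrite dot0r lt_geF // dot_gt0.
suff <- : #|[set x in l]| = #|reps c| by apply: Hm uA u0.
by apply: eq_card => x; rewrite inE ml.
Qed.

Lemma young_average V r h c k (m : nat) : isotypic V r -> V h -> h != 0 -> young setT h c ->
  (forall b B u, V u -> invar b B u -> u != 0 -> (#|B| <= m)%N) -> (1 < #|T|)%N -> k != 1%g ->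
  `|r k| <= ratr ((#|moved k|%:R ^+ 2 + #|moved k|%:R) * m%:R / (#|T| - 1)%:R).
Proof.
move=> iV Vh h0 Yh Hm T1 k1.
have N0 : 0 < N%:R :> rat by rewrite ltr0n card_Sn_gt0.
have n1 : 0 < (#|T| - 1)%:R :> rat by rewrite ltr0n subn_gt0.
have n0 : 0 < #|T|%:R :> rat by rewrite ltr0n ltnW.
set M := moved k.
(* The first sum pays the trivial bound 1 when two moved points of the conjugate share a block.
   Otherwise the lowest block is met once, and the second sum contains the bound of
   [young_bound]. *)
pose w s : rat := \sum_(x in M) \sum_(x' in M | x' != x) (c (s x) == c (s x'))%:R
   + \sum_(x in M) (#|block c (s x)|%:R)^-1.
have pair x x' : x' != x ->
    \sum_(s : Sn) (c (s x) == c (s x'))%:R <= N%:R * (m%:R / (#|T| - 1)%:R) :> rat.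
  move=> ne; rewrite mulrA ler_pdivlMr // mulrC.
  have := @slot_sum T [set x'] x (fun s y => (c y == c (s x'))%:R).
  rewrite cardsC1 -subn1 => -> //; last 2 first.
  - by rewrite inE eq_sym.
  - by move=> y s z; rewrite inE => yx'; rewrite permM tpermD // eq_sym.
  rewrite mulr_natl -sumr_const; apply: ler_sum => s _.
  rewrite (sum_indicator (fun y => c (s y) == c (s x'))) ler_nat.
  apply: leq_trans (Hm false (block c (s x')) h Vh (@young_invar T h c (s x') Yh) h0).
  rewrite -[X in (_ <= X)%N](card_preim_perm s); apply: subset_leq_card.
  by apply/subsetP => y; rewrite !inE => /andP[].
(* The mean of the inverse block size at a random point is the number of blocks divided by
   #|[T]|. *)
have single x : \sum_(s : Sn) (#|block c (s x)|%:R)^-1 <= N%:R * (m%:R / (#|T| - 1)%:R) :> rat.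
  have := @slot_sum T set0 x (fun s y => (#|block c y|%:R)^-1).
  rewrite setC0 cardsT => /(_ _ _)/esym H.
  apply: (@le_trans _ _ (N%:R * (m%:R / #|T|%:R))); last first.
    by rewrite ler_wpM2l // ler_wpM2l // lef_pV2 ?posrE // ler_nat leq_subr.
  rewrite mulrA ler_pdivlMr // mulrC -H ?inE // mulr_natl -sumr_const.
  apply: ler_sum => s _; rewrite (eq_bigl xpredT); last by move=> y; rewrite inE.
  have -> : \sum_y (#|block c (s y)|%:R)^-1 = \sum_y (#|block c y|%:R)^-1 :> rat.
    by rewrite [RHS](reindex_inj (@perm_inj _ s)).
  rewrite sum_inv_block ler_nat.
  by apply: (reps_bound (isotypic_closed iV) Vh h0 Yh) => B u; apply: Hm.
apply: le_trans (avg_bound (w := w) iV Vh h0 _) _; last first.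
  rewrite ler_rat ler_pdivrMr // /w big_split /= exchange_big /=.
  rewrite [X in _ + X]exchange_big /=.
  set E := m%:R / _ in pair single.
  apply: (@le_trans _ _ (\sum_(x in M) (#|M|%:R * (N%:R * E)) + \sum_(x in M) (N%:R * E))).
    apply: lerD; apply: ler_sum => x Mx //.
    rewrite exchange_big /=.
    apply: (@le_trans _ _ (\sum_(x' in M | x' != x) (N%:R * E))).
      by apply: ler_sum => x' /andP[_ ne]; apply: pair.
    rewrite sumr_const -[X in X <= _]mulr_natl ler_wpM2r //.
      by rewrite mulr_ge0 // divr_ge0 // ltW.
    by rewrite ler_nat; apply: subset_leq_card; apply/subsetP => y /andP[].
  rewrite !sumr_const -[X in X + _]mulr_natl -[X in _ + X]mulr_natl.
  rewrite le_eqVlt; apply/orP; left; apply/eqP; rewrite /E; ring.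
move=> s; set K := (k ^ s)%g.
have D0 := dot_ge0 h.
have w1 : 0 <= \sum_(x in M) \sum_(x' in M | x' != x) (c (s x) == c (s x'))%:R :> rat.
  by apply: sumr_ge0 => x _; apply: sumr_ge0 => x' _.
have w2 : 0 <= \sum_(x in M) (#|block c (s x)|%:R)^-1 :> rat.
  by apply: sumr_ge0 => x _; rewrite invr_ge0.
have KM y : (y \in moved K) = ((s^-1)%g y \in M).
  by rewrite !inE /K conjgE !permM -(inj_eq (@perm_inj _ s^-1%g)) permK.
have [/exists_inP[x Mx /exists_inP[x' /andP[Mx' ne] e]]|dist] :=
    boolP [exists x in M, [exists (x' | (x' \in M) && (x' != x)), c (s x) == c (s x')]].
  apply: (@le_trans _ _ (1 * dot h h)).
    by rewrite mul1r -{1}(trans1 h) dot_trans_le.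
  rewrite ler_wpM2r // -(rmorph1 (ratr : rat -> algC)) ler_rat /w.
  rewrite (bigD1 x) //= (bigD1 x') ?Mx' //= e -!addrA lerDl.
  apply: addr_ge0; first by apply: sumr_ge0.
  apply: addr_ge0 => //; apply: sumr_ge0 => y _; exact: sumr_ge0.
have [z0 Kz0] : exists z0, z0 \in moved K.
  have : #|moved K| != 0%N.
    rewrite card_moved_conj cards_eq0; apply: contra k1 => /eqP k0.
    apply/eqP/permP => x; rewrite perm1; apply/eqP; apply: contraT => kx.
    have : x \in moved k by rewrite inE.
    by rewrite k0 inE.
  by rewrite cards_eq0 => /set0Pn.
case: (arg_minnP c Kz0) => z Kz' zmin; have Kz : z \in moved K := Kz'.
have lt y : y \in moved K -> y != z -> (c z < c y)%N.
  move=> Ky ne; rewrite ltn_neqAle zmin // andbT; apply: contraNneq dist => e.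
  rewrite KM in Ky; rewrite KM in Kz; apply/exists_inP; exists (s^-1 y)%g => //.
  apply/exists_inP; exists (s^-1 z)%g; rewrite ?Kz /= ?permKV ?e //.
  by rewrite (inj_eq perm_inj) eq_sym.
have := young_bound Yh Kz lt => H.
apply: (@le_trans _ _ (ratr (#|block c z|%:R)^-1 * dot h h)).
  by rewrite fmorphV /= ratr_nat mulrC ler_pdivlMr ?ltr0n ?block_gt0 // mulrC.
rewrite ler_wpM2r // ler_rat /w; apply: ler_wpDl => //.
rewrite KM in Kz; rewrite (bigD1 (s^-1 z)%g) //= permKV lerDl.
by apply: sumr_ge0 => y _; rewrite invr_ge0.
Qed.
End ManyBlocks.

(** * Reduction to bounded support *)

Section Commutators.
Variable T : finType.
Notation Sn := {perm T}.
Notation N := #|{perm T}|.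
Notation fn := {ffun Sn -> algC^o}.
Implicit Types (g k s : Sn) (V : fn -> Prop) (f : fn) (D : seq T).

Lemma next_inj D : uniq D -> injective (next D).
Proof. by move=> uD; apply: can_inj (prev_next uD). Qed.

Definition rotation D (uD : uniq D) : Sn := perm (next_inj uD).

Lemma rotationX D (uD : uniq D) i x : (rotation uD ^+ i)%g x = iter i (next D) x.
Proof. by rewrite permX; apply: eq_iter => y; rewrite permE. Qed.

Lemma mem_rotationX D (uD : uniq D) i x : ((rotation uD ^+ i)%g x \in D) = (x \in D).
Proof. by rewrite rotationX; elim: i => //= i IH; rewrite mem_next. Qed.

Lemma rotationX_out D (uD : uniq D) i x : x \notin D -> (rotation uD ^+ i)%g x = x.
Proof.
by move=> Dx; rewrite rotationX; elim: i => //= i ->; rewrite next_nth (negPf Dx).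
Qed.

Lemma rotationX_inj D (uD : uniq D) i j x : x \in D -> (i < size D)%N -> (j < size D)%N ->
  (rotation uD ^+ i)%g x = (rotation uD ^+ j)%g x -> i = j.
Proof.
move=> Dx iD jD; rewrite !rotationX => e.
have o : fingraph.order (next D) x = size D by apply: (order_cycle (cycle_next uD) uD Dx).
by rewrite -(@findex_iter _ (next D) x i) ?o // e findex_iter ?o.
Qed.

(** Up to conjugation the element is [e^-1 * (g * e * g^-1)] with [e] a power of the rotation moving
    all of [D] and nothing else. The two factors move [D] and its preimage under [g], which are
    disjoint. *)
Lemma card_moved_commutator g D (uD : uniq D) i j : (forall x, x \in D -> g x \notin D) ->
  (i < size D)%N -> (j < size D)%N -> i != j ->
  let k := (g ^ (rotation uD ^+ j) * (g ^ (rotation uD ^+ i))^-1)%g in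
  (size D <= #|moved k| <= 2 * size D)%N.
Proof.
move=> Dg iD jD ij /=; set c := rotation uD.
have [e De] : exists e, e = (c ^+ j * (c ^+ i)^-1)%g by eexists.
have eD x : (e x \in D) = (x \in D).
  by rewrite De permM -[in RHS](mem_rotationX uD j) -[in RHS](permKV (c ^+ i)%g (_ x)) mem_rotationX.
have eout x : x \notin D -> e x = x.
  by move=> Dx; rewrite De permM rotationX_out // -{1}(rotationX_out uD i Dx) permK.
have emove x : x \in D -> e x != x.
  move=> Dx; apply: contraNneq ij => ex; apply/eqP/esym/(rotationX_inj Dx jD iD).
  by rewrite -/c -{2}ex De permM permKV.
have eVD x : (e^-1%g x \in D) = (x \in D) by rewrite -eD permKV.
have eVout x : x \notin D -> e^-1%g x = x by move=> Dx; rewrite -{1}(eout x Dx) permK.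
have eVmove x : x \in D -> e^-1%g x != x.
  by move=> Dx; rewrite -(inj_eq (@perm_inj _ e)) permKV eq_sym emove.
pose k' := (e^-1 * (g * e * g^-1))%g.
have -> : (g ^ (c ^+ j) * (g ^ (c ^+ i))^-1)%g = (k' ^ (c ^+ i))%g.
  by rewrite /k' De !conjgE !invMg !invgK !mulgA mulVg mul1g.
rewrite card_moved_conj.
have cD : #|[set x in D]| = size D by rewrite cardsE; apply/card_uniqP.
apply/andP; split.
  rewrite -cD; apply: subset_leq_card; apply/subsetP => x; rewrite !inE => Dx.
  by rewrite /k' !permM [e (g _)]eout ?permK ?eVmove // Dg // eVD.
have -> : (2 * size D)%N = (#|[set x in D]| + #|g @^-1: [set x in D]|)%N.
  rewrite -cD mul2n -addnn; congr (_ + _)%N.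
  by rewrite -(card_preim_perm g); apply: eq_card => x; rewrite !inE.
apply: leq_trans (leq_card_setU _ _).1; apply: subset_leq_card; apply/subsetP => x.
rewrite !inE; apply: contraR; rewrite negb_or => /andP[Dx Dgx].
by rewrite /k' !permM eVout // eout // permK.
Qed.

(** The mean of the squared norm of [u s - a *: f] is nonnegative. *)
Lemma average_norm_le (u : Sn -> fn) f a : \sum_s u s = (N%:R * a) *: f ->
  N%:R * `|a| ^+ 2 * dot f f <= \sum_s dot (u s) (u s).
Proof.
move=> su; have [M eM] : exists M, M = dot f f by eexists.
rewrite -eM.
have : 0 <= \sum_s dot (u s - a *: f) (u s - a *: f).
  by apply: sumr_ge0 => s _; apply: dot_ge0.
have -> : \sum_s dot (u s - a *: f) (u s - a *: f) =
  \sum_s dot (u s) (u s) - a^* * dot (\sum_s u s) f - a * dot f (\sum_s u s)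
    + \sum_(s : Sn) (a * a^* * M).
  rewrite dot_suml dot_sumr !mulr_sumr -!sumrB -big_split /=; apply: eq_bigr => s _.
  by rewrite !(dotDl, dotDr, dotNl, dotNr, dotZl, dotZr) -eM; ring.
have -> : \sum_(s : Sn) (a * a^* * M) = N%:R * (a * a^* * M) by rewrite sumr_const mulr_natl.
rewrite su dotZl dotZr -eM rmorphM /= conjC_nat normCK.
set S := \sum_s _ => h; rewrite -subr_ge0; congr (0 <= _): h; ring.
Qed.

(* For the random vector [u = sum_i g_i^s f], with [g_i] the conjugates of [g] by
   the rotations of [D], [E u = |D| r(g) f] while [E |u|^2] only involves the
   eigenvalues of the commutators [g_j g_i^-1]. *)
Lemma square_bound V r f g D (delta : rat) : isotypic V r -> V f -> f != 0 ->
  uniq D -> 0 <= delta -> (0 < size D)%N -> (forall x, x \in D -> g x \notin D) ->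
  (forall k, (size D <= #|moved k| <= 2 * size D)%N -> `|r k| <= ratr delta) ->
  `|r g| ^+ 2 <= ratr ((size D)%:R^-1 + delta).
Proof.
move=> iV Vf f0 uD; set n := size D => delta0 n0 Dg Hk.
pose gg (i : 'I_n) : Sn := (g ^ (rotation uD ^+ i))%g.
pose u s : fn := \sum_i trans (gg i ^ s)%g f.
have N0 : 0 < N%:R :> algC by rewrite ltr0n card_Sn_gt0.
have D0 := dot_gt0 f0; set M := dot f f in D0.
have su : \sum_s u s = (N%:R * (n%:R * r g)) *: f.
  rewrite exchange_big /= (eq_bigr (fun=> (N%:R * r g) *: f)); last first.
    move=> i _; rewrite -(isotypic_avg iV g Vf) [RHS](reindex_inj (mulgI (rotation uD ^+ i)%g)).
    by apply: eq_bigr => s _; rewrite conjgM.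
  by rewrite sumr_const card_ord -scaler_nat scalerA; congr (_ *: _); ring.
have low := average_norm_le su.
have term (i l : 'I_n) :
    `|\sum_s dot (trans (gg i ^ s)%g f) (trans (gg l ^ s)%g f)| <=
    N%:R * M * (if i == l then 1 else ratr delta).
  have [<-|il] := eqVneq i l.
    under eq_bigr => s _ do rewrite dot_trans.
    by rewrite sumr_const mulr1 mulr_natl ger0_norm // mulrn_wge0 // dot_ge0.
  have -> : \sum_s dot (trans (gg i ^ s)%g f) (trans (gg l ^ s)%g f) =
      dot f (\sum_s trans ((gg l * (gg i)^-1) ^ s)%g f).
    rewrite dot_sumr; apply: eq_bigr => s _.
    by rewrite dot_transl -transM (conjMg (gg l)) (conjVg (gg i)).
  rewrite (isotypic_avg iV _ Vf) dotZr -/M normrM norm_conjC normrM normr_nat.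
  rewrite [`|M|]ger0_norm ?dot_ge0 // mulrAC; apply: ler_wpM2l; first by rewrite mulr_ge0 ?dot_ge0.
  apply: Hk; apply: card_moved_commutator => //.
have up : \sum_s dot (u s) (u s) <= N%:R * M * (n%:R + n%:R ^+ 2 * ratr delta).
  have S0 : 0 <= \sum_s dot (u s) (u s) by apply: sumr_ge0 => s _; apply: dot_ge0.
  rewrite -(ger0_norm S0).
  have -> : \sum_s dot (u s) (u s) =
      \sum_i \sum_l \sum_s dot (trans (gg i ^ s)%g f) (trans (gg l ^ s)%g f).
    under eq_bigr => s _ do rewrite /u dot_suml.
    rewrite exchange_big; apply: eq_bigr => i _ /=.
    by under eq_bigr => s _ do rewrite dot_sumr; rewrite exchange_big.
  apply: le_trans (ler_norm_sum _ _ _) _.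
  apply: (@le_trans _ _ (\sum_(i < n) N%:R * M * (1 + n%:R * ratr delta))); last first.
    by rewrite sumr_const card_ord -[X in X <= _]mulr_natl le_eqVlt; apply/orP; left; apply/eqP; ring.
  apply: ler_sum => i _; apply: le_trans (ler_norm_sum _ _ _) _.
  apply: le_trans (ler_sum _ (fun l _ => term i l)) _.
  rewrite -mulr_sumr; apply: ler_wpM2l; first by rewrite mulr_ge0 ?dot_ge0.
  rewrite (bigD1 i) //= eqxx lerD2l.
  apply: (@le_trans _ _ (\sum_(l < n) ratr delta)); last first.
    by rewrite sumr_const card_ord mulr_natl.
  rewrite big_mkcond /=; apply: ler_sum => l _.
  by rewrite eq_sym; case: eqP => _; rewrite //= ler0q.
have := le_trans low up.
rewrite normrM normr_nat exprMn -/M mulrAC.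
rewrite ler_pM2l ?mulr_gt0 // => h.
have np : 0 < n%:R :> algC by rewrite ltr0n.
rewrite -(@ler_pM2l _ (n%:R ^+ 2)) ?exprn_gt0 //; apply: le_trans h _.
rewrite rmorphD fmorphV /= ratr_nat mulrDr expr2 mulfK ?lt0r_neq0 //.
Qed.
End Commutators.

(** * The dichotomy for normalised characters *)

Section Dichotomy.
Implicit Types (T : finType).

Lemma dichotomy (M : nat) : (0 < M)%N -> exists K n0 : nat,
  forall T (V : {ffun {perm T} -> algC^o} -> Prop) r f (g : {perm T}),
  isotypic V r -> V f -> f != 0 -> (n0 <= #|T|)%N -> (K <= #|moved g|)%N ->
  (exists b B u, [/\ V u, u != 0, invar b B u, (40 * #|~: B| <= #|T|)%N &
      `|r g| <= ratr (1 - 4 * #|~: B|%:R / #|T|%:R)]) \/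
  `|r g| <= M%:R^-1.
Proof.
(* [s1] separated points with commutator bound 1/[s1] yield 1/[M]^2. [S] bounds the support of the
   resulting commutators, and blocks below #|[T]|/[W] count as small. Medium blocks need [m]
   separated points per commutator, hence [s2] = 3[m] points for [g], hence 3[s2] moved points. *)
move=> M0; pose s1 := (2 * M ^ 2)%N; pose S := (2 * s1)%N; pose W := (8 * M ^ 2 * S ^ 2)%N.
pose m := (320 * M ^ 2 * W)%N; pose s2 := (3 * m)%N; pose q := (4 * M ^ 2)%N.
exists (3 * s2)%N, (200 + 64 * M ^ 2 + W * (q ^ 2 + 2 * s2))%N => T V r f g iV Vf f0 nT gK.
have T200 : (200 <= #|T|)%N by apply: leq_trans nT; rewrite -addnA leq_addr.
have T1 : (1 <= #|T|)%N by apply: leq_trans T200.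
have M2 : (0 < M ^ 2)%N by rewrite expn_gt0 M0.
have s10 : (0 < s1)%N by rewrite /s1; lia.
have S0 : (0 < S)%N by rewrite /S; lia.
have W0 : (0 < W)%N by rewrite /W muln_gt0 expn_gt0 S0 andbT; lia.
have m0 : (0 < m)%N by rewrite /m muln_gt0 W0 andbT; lia.
have q0 : (0 < q)%N by rewrite /q; lia.
have s12 : (s1 <= s2)%N by rewrite /s1 /s2 /m; nia.
have s20 : (0 < s2)%N by lia.
have cV := isotypic_closed iV.
have key b : exists B u, [/\ V u, u != 0, invar b B u &
    maximal_block setT V b B /\ forall y, y \notin B -> spread b B y u = 0].
  have [B [u [_ Vu uB u0 Bmax]]] := maximal_block_exists setT b Vf f0.
  exists B, u; split=> //; split=> // y By.
  by apply: spread_eq0 cV _ Vu uB Bmax _ By; rewrite ?subsetT ?inE.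
(* [square_bound] gives 1/[s] + 1/[s1], at most 2/[s1] = 1/[M]^2. *)
have reduce s : (0 < s)%N -> (s1 <= s)%N -> (s <= s2)%N ->
    (forall k, (s <= #|moved k| <= 2 * s)%N -> `|r k| <= ratr (s1%:R)^-1) -> `|r g| <= M%:R^-1.
  move=> s0 s1s ss2 Hk.
  have [|D cD Dg] := @separated_set T g s; first by lia.
  have sz : size (enum D) = s by rewrite -cardE.
  have := @square_bound T V r f g (enum D) (s1%:R)^-1 iV Vf f0 (enum_uniq _).
  rewrite sz invr_ge0 ler0n => /(_ isT s0 _ Hk) H.
  rewrite -(@ler_pXn2r _ 2) ?nnegrE ?invr_ge0 ?ler0n //.
  apply: le_trans (H _) _; first by move=> x; rewrite !mem_enum; apply: Dg.
  rewrite -(ratr_nat algC M) -fmorphV -rmorphXn ler_rat /=.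
  apply: (@le_trans _ _ (s1%:R^-1 + s1%:R^-1)).
    by rewrite lerD2r lef_pV2 ?posrE ?ltr0n // ler_nat.
  rewrite /s1 natrM natrX exprVn.
  have : (M%:R : rat) != 0 by rewrite pnatr_eq0 -lt0n.
  by move: (M%:R : rat) => x x0; rewrite le_eqVlt; apply/orP; left; apply/eqP; field.
have [B1 [u1 [Vu1 u10 uB1 [max1 sp1]]]] := key false.
have [B2 [u2 [Vu2 u20 uB2 [max2 sp2]]]] := key true.
have near b B u : V u -> u != 0 -> invar b B u -> (forall y, y \notin B -> spread b B y u = 0) ->
    (40 * #|~: B| <= #|T|)%N -> exists b B u, [/\ V u, u != 0, invar b B u, (40 * #|~: B| <= #|T|)%N &
      `|r g| <= ratr (1 - 4 * #|~: B|%:R / #|T|%:R)].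
  move=> Vu u0 uB sp jn; exists b, B, u; split=> //.
  apply: near_trivial_bound iV Vu u0 uB sp T200 jn _.
  by apply: leq_trans gK; lia.
have [/(near _ _ _ Vu1 u10 uB1 sp1)|n1] := leqP (40 * #|~: B1|) #|T|; first by left.
have [/(near _ _ _ Vu2 u20 uB2 sp2)|n2] := leqP (40 * #|~: B2|) #|T|; first by left.
right.
have mid b B u : V u -> u != 0 -> invar b B u -> (forall y, y \notin B -> spread b B y u = 0) ->
    (#|T| < 40 * #|~: B|)%N -> (#|T| <= W * #|B|)%N -> `|r g| <= M%:R^-1.
  (* With [s2] points the commutators have between 3[m] and 6[m] moved points. The last summand of
     the threshold on #|[T]| makes a block of #|[T]|/[W] points large compared with that support. *)
  move=> Vu u0 uB sp jn bn; apply: (reduce s2) => // k /andP[k1 k2].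
  have Bbig : (q ^ 2 + 2 * s2 <= #|B|)%N.
    rewrite -(leq_pmul2l W0); apply: leq_trans bn; apply: leq_trans nT; exact: leq_addl.
  have := mid_bound (m := m) (q := q) (W := W) iV Vu u0 uB sp T200 (ltnW jn) bn m0 q0 W0 k1.
  move=> /(_ _)/le_trans; apply.
    lia.
  rewrite ler_rat.
  have n64 : 64 * (M%:R ^+ 2) <= #|T|%:R :> rat.
    rewrite -natrX -natrM ler_nat; apply: leq_trans nT; lia.
  have Wr : 0 < W%:R :> rat by rewrite ltr0n.
  have Mr : 0 < M%:R :> rat by rewrite ltr0n.
  rewrite /m /q /s1 (natrM rat (320 * M ^ 2) W) (natrM rat 320) (natrM rat 4) (natrM rat 2).
  by rewrite (natrX rat M); apply: mid_const_arith.
have [|W1] := leqP #|T| (W * #|B1|); first exact: (mid _ _ _ Vu1 u10 uB1 sp1).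
have [|W2] := leqP #|T| (W * #|B2|); first exact: (mid _ _ _ Vu2 u20 uB2 sp2).
(* Both the largest symmetric and the largest alternating block are now below #|[T]|/[W], so the
   chain of blocks handles every commutator. *)
apply: (reduce s1) => // k /andP[k1 k2].
have [h [c [Vh h0 Yh]]] := young_exists cV Vf f0.
have small b B u : V u -> invar b B u -> u != 0 -> (#|B| <= #|T| %/ W)%N.
  move=> Vu uB u0; rewrite leq_divRL // mulnC.
  case: b uB => uB.
    by apply: leq_trans (ltnW W2); rewrite leq_pmul2l //; apply: max2 uB u0 => //; apply: subsetT.
  by apply: leq_trans (ltnW W1); rewrite leq_pmul2l //; apply: max1 uB u0 => //; apply: subsetT.
have kn1 : k != 1%g.
  apply: contraTneq k1 => ->; rewrite -ltnNge.
  have -> : moved (1 : {perm T}) = set0 by apply/setP => x; rewrite !inE perm1 eqxx.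
  by rewrite cards0.
apply: le_trans (young_average iV Vh h0 Yh small _ kn1) _; first exact: leq_trans T200.
rewrite ler_rat.
have kS : #|moved k|%:R <= S%:R :> rat by rewrite ler_nat.
have tW : (#|T| %/ W)%:R * W%:R <= #|T|%:R :> rat by rewrite -natrM ler_nat leq_divM.
have n200 : 200 <= #|T|%:R :> rat by rewrite ler_nat.
have S1 : 1 <= S%:R :> rat by rewrite ler1n.
have Mr : 0 < M%:R :> rat by rewrite ltr0n.
rewrite (natrB _ T1).
have eW : W%:R = 8 * M%:R ^+ 2 * S%:R ^+ 2 :> rat.
  by rewrite /W (natrM rat (8 * M ^ 2)) (natrM rat 8) (natrX rat M) (natrX rat S).
rewrite /s1 (natrM rat 2) (natrX rat M).
exact: (young_arith Mr S1 n200 (ler0n _ _) (ler0n _ _) kS tW eW).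
Qed.
End Dichotomy.

(** * Isotypic components and multiplicities *)

Section IrreducibleCharacters.
Variable T : finType.
Notation Sn := {perm T}.
Notation N := #|{perm T}|.
Notation fn := {ffun Sn -> algC^o}.
Notation G := [set: {perm T}]%G.
Implicit Types (i j : Iirr G) (g k s w : Sn) (f : fn) (b : bool) (B : {set T}).

Lemma card_perm_group : #|G| = N.
Proof. by rewrite cardsT. Qed.

Lemma N_gt0 : 0 < N%:R :> algC.
Proof. by rewrite ltr0n card_Sn_gt0. Qed.

Lemma irr_orthogonality i j w :
  \sum_(x : Sn) 'chi_i (x * w)%g * 'chi_j x^-1%g = (i == j)%:R * (N%:R * 'chi_i w / 'chi_i 1%g).
Proof.
have := generalized_orthogonality_relation w i j; rewrite card_perm_group => h.
rewrite -mulrA mulrCA -h mulrA mulfV ?lt0r_neq0 ?N_gt0 // mul1r.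
by apply: eq_bigl => x; rewrite inE.
Qed.

(** As a function of [w] the left side is a class function, and by orthogonality its only nonzero
    coefficient is the one on ['chi_i]. *)
Lemma irr_class_average i g w :
  \sum_(s : Sn) 'chi_i (g ^ s * w)%g = N%:R * 'chi_i g * 'chi_i w / 'chi_i 1%g.
Proof.
pose F := [ffun w : Sn => \sum_(s : Sn) 'chi_i (g ^ s * w)%g].
have FC : is_class_fun <<G>>%g F.
  rewrite genGid; apply: intro_class_fun => [x y _ _|x]; last by rewrite inE.
  rewrite (reindex_inj (mulIg y)) /=; apply: eq_bigr => s _.
  by rewrite conjgM -conjMg cfunJ ?inE.
pose theta := Cfun 0 FC.
have e : theta = (N%:R * 'chi_i g / 'chi_i 1%g) *: 'chi_i.
  rewrite [LHS]cfun_sum_cfdot (bigD1 i) //= [X in _ + X]big1 ?addr0 => [|j ji].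
    congr (_ *: _); rewrite cfdotE card_perm_group.
    apply: (canLR (mulKf (lt0r_neq0 N_gt0))).
    rewrite (eq_bigl xpredT) => [|x]; last by rewrite inE.
    under eq_bigr => x _ do rewrite cfunE mulr_suml.
    rewrite exchange_big /= (eq_bigr (fun=> N%:R * 'chi_i g / 'chi_i 1%g)).
      by rewrite sumr_const -[LHS]mulr_natl.
    move=> s _; have -> : 'chi_i g = 'chi_i (g ^ s)%g by rewrite cfunJ ?inE.
    have := irr_orthogonality i i (g ^ s)%g; rewrite eqxx mul1r => <-; apply: eq_bigr => x _.
    by rewrite -irr_inv; congr (_ * _); rewrite -(cfunJ _ _ (in_setT (g ^ s)%g)) conjgE mulgA mulKg.
  rewrite cfdotE card_perm_group (eq_bigl xpredT) => [|x]; last by rewrite inE.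
  under eq_bigr => x _ do rewrite cfunE mulr_suml.
  rewrite exchange_big /= big1 ?mulr0 ?scale0r // => s _.
  have := irr_orthogonality i j (g ^ s)%g; rewrite eq_sym (negPf ji) mul0r => e0; rewrite -[RHS]e0.
  apply: eq_bigr => x _; rewrite -irr_inv; congr (_ * _).
  by rewrite -(cfunJ _ _ (in_setT (g ^ s)%g)) conjgE mulgA mulKg.
have := congr1 (fun phi : 'CF(G) => phi w) e; rewrite !cfunE => ->.
by rewrite mulrAC.
Qed.

(** The image of the central idempotent of ['chi_i], acting on functions by convolution: the
    isotypic component. *)
Definition irr_space i f : Prop :=
  forall x, \sum_(y : Sn) 'chi_i (x * y^-1)%g * f y = N%:R / 'chi_i 1%g * f x.

Definition irr_ratio i g : algC := 'chi_i g / 'chi_i 1%g.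

Lemma irr_space_isotypic i : isotypic (irr_space i) (irr_ratio i).
Proof.
have T_closed g f : irr_space i f -> irr_space i (trans g f).
  move=> Vf x; rewrite ffunE -Vf [RHS](reindex_inj (mulgI g)) /=.
  apply: eq_bigr => y _; rewrite ffunE; congr (_ * _).
  by rewrite -[RHS](cfunJ _ _ (in_setT g)) conjgE invMg !mulgA mulVg mul1g mulgKV.
split.
  split.
  - move=> f h Vf Vh x; rewrite ffunE mulrDr -Vf -Vh -big_split /=.
    by apply: eq_bigr => y _; rewrite ffunE mulrDr.
  - move=> a f Vf x; rewrite ffunE [a *: f x]/(a * f x) mulrCA -Vf mulr_sumr.
    by apply: eq_bigr => y _; rewrite ffunE [a *: f y]/(a * f y) mulrCA.
  - by move=> x y f _ _; apply: T_closed.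
move=> g f Vf; apply/ffunP => x; rewrite sum_ffunE ffunE.
have d0 := irr1_neq0 i; have n0 := lt0r_neq0 N_gt0.
(* Convolution with the character reproduces [f], so averaging over conjugates of [g] acts on the
   character alone. *)
have eV z : f z = 'chi_i 1%g / N%:R * \sum_(y : Sn) 'chi_i (z * y^-1)%g * f y.
  by rewrite Vf; field; rewrite d0 n0.
under eq_bigr => s _ do rewrite ffunE eV.
rewrite -mulr_sumr exchange_big /=.
rewrite (eq_bigr (fun y => N%:R * irr_ratio i g * ('chi_i (x * y^-1)%g * f y))); last first.
  move=> y _; rewrite -mulr_suml mulrA; congr (_ * _).
  under eq_bigr => s _ do rewrite -mulgA.
  by rewrite irr_class_average /irr_ratio mulrAC mulrA.
rewrite -mulr_sumr Vf; set c := N%:R * irr_ratio i g.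
change ('chi_i 1%g / N%:R * (c * (N%:R / 'chi_i 1%g * (f x : algC))) = c * (f x : algC)).
by move: c (f x : algC) => c z; field; rewrite d0 n0.
Qed.

Lemma irr_space_neq0 i : exists2 f, irr_space i f & f != 0.
Proof.
exists [ffun x => 'chi_i x].
  move=> x; rewrite (reindex_inj invg_inj) /= ffunE.
  under eq_bigr => y _.
    rewrite ffunE invgK -(cfunJ _ _ (in_setT x)) conjgE mulgA mulKg; over.
  by rewrite irr_orthogonality eqxx mul1r mulrAC.
apply: contraTneq (irr1_neq0 i) => /ffunP/(_ 1%g); rewrite !ffunE => ->.
by rewrite eqxx.
Qed.
End IrreducibleCharacters.

(** * Multiplicities of block characters and sums of squared degrees *)

Section Multiplicity.
Variable T : finType.
Notation Sn := {perm T}.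
Notation N := #|{perm T}|.
Notation fn := {ffun Sn -> algC^o}.
Notation G := [set: {perm T}]%G.
Implicit Types (i j : Iirr G) (g k s w : Sn) (f : fn) (b : bool) (B : {set T}).

Definition sgn b s : algC := (-1) ^+ (b && odd_perm s).

Lemma sgnM b s s' : sgn b (s * s') = sgn b s * sgn b s'.
Proof. by rewrite /sgn odd_permM; case: b; rewrite ?mulr1 // signr_addb. Qed.

(** Induction on the number of moved points: multiplying [s] by [tperm x (s x)] makes it fix [x] as
    well. *)
Lemma invar_Sym b B f s : invar b B f -> s \in perm.Sym B -> trans s f = sgn b s *: f.
Proof.
move=> fB; have [m] := ubnP #|moved s|; elim: m s => // m IH s; rewrite ltnS inE => sm Bs.
have [s1|/set0Pn[x sx]] := eqVneq (moved s) set0.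
  have -> : s = 1%g.
    apply/permP => x; rewrite perm1; apply/eqP/negPn/negP => sx.
    have : x \in moved s by rewrite inE.
    by rewrite s1 inE.
  by rewrite trans1 /sgn odd_perm1 andbF expr0 scale1r.
pose t := tperm x (s x); have es : s = (s * t * t)%g by rewrite -mulgA tperm2 mulg1.
rewrite inE in sx.
have Bx : x \in B by apply: (subsetP Bs); rewrite inE.
have Bsx : s x \in B by rewrite perm_closed.
have tE : trans t f = sgn b t *: f.
  by rewrite fB 1?eq_sym // /sgn odd_tperm eq_sym sx andbT.
rewrite es transM IH ?linearZ /= ?tE ?scalerA; last 2 first.
- apply: leq_trans sm; apply: proper_card; apply/properP; split.
    apply/subsetP => y; rewrite !inE permM; apply: contraNneq => sy.
    rewrite sy tpermD //; first by apply: contraNneq sx => ->; rewrite sy.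
    by apply: contraNneq sx => e; rewrite -(inj_eq (@perm_inj _ s)) e sy.
  by exists x; rewrite !inE // permM tpermR eqxx.
- rewrite inE perm_onM //; apply/subsetP => z; rewrite inE.
  by case: tpermP => [->|->|]; rewrite ?eqxx.
by rewrite -sgnM.
Qed.

(** The multiplicity of the trivial or sign character of Sym([B]) in the restriction of ['chi_i]. *)
Definition mult b B i : algC :=
  (\sum_(s in perm.Sym B) sgn b s * 'chi_i s) / #|perm.Sym B|%:R.

Lemma mult_nat b B i : mult b B i \in Num.nat.
Proof.
pose rho s : 'M[algC]_1 := (sgn b s)%:M.
have rhoP : mx_repr (perm.Sym B) rho.
  split; first by rewrite /rho /sgn odd_perm1 andbF expr0.
  by move=> x y _ _; rewrite /rho sgnM scalar_mxM.
pose psi := cfRepr (MxRepresentation rhoP).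
have -> : mult b B i = '['Res[perm.Sym B] 'chi_i, psi].
  rewrite cfdotE mulrC; congr (_ * _); apply: eq_bigr => s Hs.
  rewrite cfResE ?subsetT // cfunE /= Hs mulr1n mxtrace_scalar mulr1n mulrC.
  by rewrite /sgn rmorph_sign.
by rewrite Cnat_cfdot_char ?cfRes_char ?irr_char ?cfRepr_char.
Qed.

(** Exchanging the sums leaves the regular character on Sym([B]), which vanishes off the identity.
    The value is the degree of the induced character. *)
Lemma sum_mult b B : \sum_i 'chi_i 1%g * mult b B i = N%:R / #|perm.Sym B|%:R.
Proof.
rewrite /mult; under eq_bigr => i _ do rewrite mulrA.
rewrite -mulr_suml; congr (_ / _).
under eq_bigr => i _ do rewrite mulr_sumr.
rewrite exchange_big /= (bigD1 1%g) ?group1 //= [X in _ + X]big1 ?addr0.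
  rewrite /sgn odd_perm1 andbF -card_perm_group.
  have := cfRegE G 1%g; rewrite eqxx mulr1n cfReg_sum sum_cfunE => <-.
  by apply: eq_bigr => i _; rewrite !cfunE mul1r.
move=> s /andP[_ s1]; have := cfRegE G s; rewrite (negPf s1) mulr0n cfReg_sum sum_cfunE => e.
rewrite (eq_bigr (fun i => sgn b s * ('chi_i 1%g * 'chi_i s))) => [|i _]; last by rewrite mulrCA.
rewrite -mulr_sumr [X in _ * X](_ : _ = 0) ?mulr0 // -[RHS]e.
by apply: eq_bigr => i _; rewrite cfunE.
Qed.

Lemma mult_neq0 b B i f : irr_space i f -> f != 0 -> invar b B f -> mult b B i != 0.
Proof.
move=> Vf f0 fB; have n0 := lt0r_neq0 (N_gt0 T); have d0 := irr1_neq0 i.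
have h0 : #|perm.Sym B|%:R != 0 :> algC by rewrite pnatr_eq0 -lt0n cardG_gt0.
apply: contraNneq f0 => m0.
have m0' : \sum_(s in perm.Sym B) sgn b s * 'chi_i s = 0.
  by apply: (mulIf (invr_neq0 h0)); rewrite mul0r.
pose theta w : algC := \sum_(s in perm.Sym B) sgn b s * 'chi_i (s * w)%g.
(* By orthogonality the squared norm of [theta] is a multiple of the conjugate of the sum defining
   [mult], which is zero. The Sym([B])-average of [f], equal to [f] by invariance, is a convolution
   with [theta], so [f] vanishes. *)
have th0 w : theta w = 0.
  suff : \sum_w `|theta w| ^+ 2 == 0.
    rewrite psumr_eq0 => [/allP/(_ w)|w' _]; last by rewrite exprn_ge0.
    by rewrite mem_index_enum => /(_ isT); rewrite expf_eq0 /= normr_eq0 => /eqP.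
  apply/eqP; rewrite (eq_bigr (fun w => \sum_(s in perm.Sym B) \sum_(s' in perm.Sym B)
     sgn b s * sgn b s' * ('chi_i (s * w)%g * ('chi_i (s' * w)%g)^*))); last first.
    move=> v _; rewrite normCK /theta mulr_suml; apply: eq_bigr => s _.
    rewrite rmorph_sum mulr_sumr; apply: eq_bigr => s' _.
    by rewrite rmorphM /= {2}/sgn rmorph_sign -/(sgn b s'); ring.
  rewrite exchange_big /= big1 // => s Hs; rewrite exchange_big /=.
  rewrite (eq_bigr (fun s' => (N%:R / 'chi_i 1%g) *
      (sgn b (s' * s^-1) * 'chi_i (s' * s^-1)%g)^* )).
    rewrite -mulr_sumr (reindex_inj (mulIg s)) /= (eq_bigl (fun x => x \in perm.Sym B)); last first.
      by move=> x; rewrite groupMr.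
    by under eq_bigr => x _ do rewrite mulgK; rewrite -rmorph_sum m0' rmorph0 mulr0.
  move=> s' Hs'; rewrite -mulr_sumr (reindex_inj (mulgI s^-1%g)) /=.
  have -> : \sum_(w : Sn) 'chi_i (s * (s^-1 * w))%g * ('chi_i (s' * (s^-1 * w))%g)^* =
      (N%:R * 'chi_i (s' * s^-1)%g / 'chi_i 1%g)^*.
    have := irr_orthogonality i i (s' * s^-1)%g; rewrite eqxx mul1r => <-.
    rewrite rmorph_sum; apply: eq_bigr => v _; rewrite rmorphM /= irr_inv conjCK mulrC mulKVg.
    by congr (_^* * _); rewrite -[RHS](cfunJ _ _ (in_setT v)) conjgE !mulgA mulVg mul1g.
  rewrite sgnM [sgn b s^-1%g]/sgn odd_permV -/(sgn b s) !rmorphM /= fmorphV /= conjC_nat.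
  have sr v : (sgn b v)^* = sgn b v by rewrite /sgn rmorph_sign.
  by rewrite !sr (conj_natr (Cnat_irr1 i)); ring.
have Hu s : s \in perm.Sym B -> trans s f = sgn b s *: f by apply: invar_Sym.
have eV z : (f z : algC) = 'chi_i 1%g / N%:R * \sum_(y : Sn) 'chi_i (z * y^-1)%g * f y.
  by rewrite Vf; field; rewrite d0 n0.
apply/eqP/ffunP => x; rewrite [RHS]ffunE.
have sumE : \sum_(s in perm.Sym B) sgn b s * (f (s * x)%g : algC) = #|perm.Sym B|%:R * (f x : algC).
  rewrite mulr_natl -sumr_const; apply: eq_bigr => s Hs.
  have /ffunP/(_ x) := Hu s Hs; rewrite !ffunE => ->; rewrite [_ *: _]/(_ * _) mulrA.
  by rewrite -expr2 /sgn sqrr_sign mul1r.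
apply: (mulfI h0); rewrite mulr0 -[LHS]sumE.
under eq_bigr => s _ do rewrite eV mulrCA mulr_sumr.
rewrite -mulr_sumr exchange_big /= big1 ?mulr0 // => y _.
transitivity (theta (x * y^-1)%g * (f y : algC)); last by rewrite th0 mul0r.
by rewrite mulr_suml; apply: eq_bigr => s _; rewrite mulgA mulrA.
Qed.

(** A nonzero multiplicity is at least 1, so [sum_mult] bounds the sum of the degrees by #|[T]|! /
    #|[B]|!, and the sum of squares is at most the square of the sum. *)
Lemma sum_irr1_sqr_le b B :
  \sum_(i | mult b B i != 0) 'chi_i 1%g ^+ 2 <= (#|T| ^ (2 * #|~: B|))%:R.
Proof.
have n0 := N_gt0 T; have d_ge0 i := ltW (irr1_gt0 i).
have S1 : \sum_(i | mult b B i != 0) 'chi_i 1%g <= N%:R / #|perm.Sym B|%:R.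
  rewrite -(sum_mult b B) big_mkcond /=; apply: ler_sum => i _.
  case: ifP => [m0|_]; last by rewrite mulr_ge0 // natr_ge0 // mult_nat.
  rewrite ler_peMr //; have /natrP[m em] := mult_nat b B i.
  by move: m0; rewrite em pnatr_eq0 -lt0n ler1n.
have S2 : N%:R / #|perm.Sym B|%:R <= (#|T| ^ #|~: B|)%:R :> algC.
  rewrite ler_pdivrMr ?ltr0n ?cardG_gt0 // -natrM ler_nat -card_perm_group.
  have -> : #|[set: Sn]| = #|T|`!.
    rewrite -(cardsT T) -(perm.card_Sym [set: T]); apply: eq_card => s; rewrite !inE.
    by apply/esym/subsetP => x; rewrite inE.
  rewrite perm.card_Sym -(cardsC B); move: #|B| #|~: B| => a c.
  elim: c => [|c IH]; first by rewrite addn0 expn0 mul1n.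
  rewrite addnS factS expnS -mulnA leq_mul //; apply: leq_trans IH _.
  by rewrite leq_mul2r; case: c => [|c]; rewrite ?leqnn ?orbT // leq_exp2r // leqnSn orbT.
rewrite mulnC expnM natrX; apply: (@le_trans _ _ ((\sum_(i | mult b B i != 0) 'chi_i 1%g) ^+ 2)).
  rewrite expr2 mulr_suml; apply: ler_sum => i mi; rewrite expr2 ler_wpM2l //.
  by rewrite (bigD1 i) //= lerDl sumr_ge0.
rewrite ler_pXn2r ?nnegrE ?ler0n ?sumr_ge0 //.
exact: le_trans S2.
Qed.
End Multiplicity.

(** * Convolution powers *)

Section ConvolutionPowers.
Variable T : finType.
Notation Sn := {perm T}.
Notation N := #|{perm T}|.
Notation G := [set: {perm T}]%G.
Implicit Types (i j : Iirr G) (g k s w x y : Sn) (b : bool) (B : {set T}) (C : {set Sn}).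

(** Rational values can be sent both to [algC], where characters live, and to the reals of the final
    statement. *)
Fixpoint ratpow C (k : nat) x : rat :=
  if k is k'.+1 then \sum_y ratpow C k' y * ((y^-1 * x \in C)%g%:R / #|C|%:R) else (x == 1%g)%:R.

Lemma class_average (F : Sn -> algC) g :
  (\sum_(c in (g ^: G)%g) F c) / #|(g ^: G)%g|%:R = (\sum_s F (g ^ s)%g) / N%:R.
Proof.
have n0 := lt0r_neq0 (N_gt0 T).
have cN : (#|(g ^: G)%g| * #|('C_G[g])%g| = N)%N.
  by rewrite mulnC -index_cent1 Lagrange ?subsetIl // card_perm_group.
have C0 : #|'C_G[g]%g|%:R != 0 :> algC by rewrite pnatr_eq0 -lt0n cardG_gt0.
have c0 : #|(g ^: G)%g|%:R != 0 :> algC.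
  by apply: contraNneq n0 => c0; rewrite -cN natrM c0 mul0r.
rewrite [X in _ = X / _](partition_big (fun s => (g ^ s)%g) (mem (g ^: G)%g)) /=; last first.
  by move=> s _; rewrite memJ_class ?inE.
rewrite [X in _ = X / _](eq_bigr (fun c => #|'C_G[g]%g|%:R * F c)); last first.
  move=> c /imsetP[s0 _ ->].
  rewrite (eq_bigr (fun=> F (g ^ s0)%g)) => [|s /eqP-> //].
  rewrite sumr_const mulr_natl; congr (_ *+ _).
  rewrite -(card_rcoset 'C_G[g]%g s0); apply: eq_card => s.
  transitivity ((g ^ s)%g == (g ^ s0)%g) => //.
  rewrite mem_rcoset inE in_setT cent1E /= -(inj_eq (conjg_inj s0^-1%g)) -!conjgM mulgV conjg1.
  by rewrite conjgE -(inj_eq (mulgI (s * s0^-1)%g)) mulKVg eq_sym.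
by rewrite -mulr_sumr -cN natrM; field; rewrite c0 C0.
Qed.

(** Fourier inversion: convolution with the class measure multiplies the component of ['chi_i] by
    [irr_ratio i g^-1]. *)
Lemma ratpow_irr g (k : nat) x : ratr (ratpow (g ^: G)%g k x) =
  N%:R^-1 * \sum_i 'chi_i 1%g * irr_ratio i g^-1%g ^+ k * 'chi_i x.
Proof.
have n0 := lt0r_neq0 (N_gt0 T).
elim: k x => [|k IH] x /=.
  rewrite ratr_nat; have := cfRegE G x; rewrite cfReg_sum sum_cfunE card_perm_group => e.
  under eq_bigr => i _ do rewrite expr0 mulr1.
  have -> : \sum_(i : Iirr G) 'chi_i 1%g * 'chi_i x = N%:R *+ (x == 1%g).
    by rewrite -e; apply: eq_bigr => i _; rewrite cfunE.
  by rewrite mulrnAr mulVf.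
rewrite rmorph_sum /=.
under eq_bigr => y _ do rewrite rmorphM /= IH -mulrA mulr_suml.
rewrite -mulr_sumr exchange_big /=; congr (_ * _); apply: eq_bigr => i _.
under eq_bigr => y _ do rewrite -(mulrA ('chi_i 1%g * irr_ratio i g^-1%g ^+ k)).
rewrite -mulr_sumr exprSr -!mulrA; congr (_ * (_ * _)).
rewrite (reindex_inj (inj_comp (mulgI x) invg_inj)) /=.
under eq_bigr => y _ do rewrite invMg invgK mulgKV fmorph_div /= !ratr_nat mulrA.
rewrite -mulr_suml.
have -> : \sum_y 'chi_i (x * y^-1)%g * (y \in g ^: G)%g%:R = \sum_(y in (g ^: G)%g) 'chi_i (x * y^-1)%g.
  by rewrite [RHS]big_mkcond; apply: eq_bigr => y _; case: ifP; rewrite ?mulr1 ?mulr0.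
rewrite class_average.
under eq_bigr => s _.
  rewrite -conjVg -(cfunJ _ _ (in_setT x)) conjgE mulgA mulKg; over.
by rewrite irr_class_average /irr_ratio; field; rewrite n0 irr1_neq0.
Qed.

Lemma ratpow_ge0 C (k : nat) x : 0 <= ratpow C k x.
Proof.
elim: k x => [|k IH] x /=; first exact: ler0n.
by apply: sumr_ge0 => y _; rewrite mulr_ge0 // divr_ge0.
Qed.

(** The Plancherel identity, with two exponents because the squared heat kernel mixes different
    powers. *)
Lemma ratpow_dot g (k l : nat) :
  ratr (N%:R * \sum_x ratpow (g ^: G)%g k x * ratpow (g ^: G)%g l x) =
  \sum_i 'chi_i 1%g ^+ 2 * (irr_ratio i g^-1%g ^+ k * (irr_ratio i g^-1%g)^* ^+ l).
Proof.
have n0 := lt0r_neq0 (N_gt0 T).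
have orth i j : \sum_(x : Sn) 'chi_i x * ('chi_j x)^* = (i == j)%:R * N%:R.
  have := irr_orthogonality i j 1%g; rewrite mulfK ?irr1_neq0 // => <-.
  by apply: eq_bigr => x _; rewrite mulg1 irr_inv.
have cN : (N%:R^-1 : algC)^* = N%:R^-1 by rewrite fmorphV /= conjC_nat.
have conj_rat (q : rat) : (ratr q : algC)^* = ratr q by rewrite fmorph_rat.
pose A m i : algC := 'chi_i 1%g * irr_ratio i g^-1%g ^+ m.
have QE m x : ratr (ratpow (g ^: G)%g m x) = N%:R^-1 * \sum_i A m i * 'chi_i x.
  by rewrite ratpow_irr.
have -> : ratr (N%:R * \sum_x ratpow (g ^: G)%g k x * ratpow (g ^: G)%g l x) =
    N%:R * \sum_(x : Sn) \sum_i \sum_j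
      (N%:R^-1 * N%:R^-1 * A k i * (A l j)^*) * ('chi_i x * ('chi_j x)^*).
  rewrite rmorphM /= ratr_nat rmorph_sum; congr (_ * _); apply: eq_bigr => x _.
  rewrite rmorphM /= -[ratr (ratpow _ l x)]conj_rat !QE rmorphM /= cN.
  rewrite rmorph_sum mulrACA mulr_suml mulr_sumr; apply: eq_bigr => i _.
  rewrite !mulr_sumr; apply: eq_bigr => j _; rewrite rmorphM /=; ring.
rewrite exchange_big /= mulr_sumr; apply: eq_bigr => i _.
rewrite exchange_big /= (bigD1 i) //= [X in _ + X]big1 ?addr0; last first.
  by move=> j ji; rewrite -mulr_sumr orth eq_sym (negPf ji) mul0r mulr0.
rewrite -mulr_sumr orth eqxx mul1r /A rmorphM rmorphXn /= (conj_natr (Cnat_irr1 i)).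
by field.
Qed.
Lemma moved_inv g : moved g^-1%g = moved g.
Proof.
apply/setP => x; rewrite !inE -(inj_eq (@perm_inj _ g)) permKV eq_sym //.
Qed.
End ConvolutionPowers.

(** Each character is charged either to a pair ([b], [B]) of nonzero multiplicity, where
    [sum_irr1_sqr_le] bounds the total degree weight, or to the bulk, where squared degrees sum to
    at most the group order. *)
Theorem ratpow_bound (M : nat) : (0 < M)%N -> exists K n0 : nat,
  forall (T : finType) (g : {perm T}) (k l : nat), (n0 <= #|T|)%N -> (K <= #|moved g|)%N ->
  #|{perm T}|%:R *
    (\sum_x ratpow (g ^: [set: {perm T}])%g k x * ratpow (g ^: [set: {perm T}])%g l x) <=
  \sum_(p : bool * {set T} | (40 * #|~: p.2| <= #|T|)%N)
     (#|T| ^ (2 * #|~: p.2|))%:R * (1 - 4 * #|~: p.2|%:R / #|T|%:R) ^+ (k + l)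
  + #|{perm T}|%:R * M%:R^-1 ^+ (k + l).
Proof.
move=> M0; have [K [n0 H]] := dichotomy M0; exists K, n0 => T g k l nT gK.
have N0 := N_gt0 T.
pose a (B : {set T}) : rat := 1 - 4 * #|~: B|%:R / #|T|%:R.
have a_ge0 B : (40 * #|~: B| <= #|T|)%N -> 0 <= a B.
  move=> jn; rewrite subr_ge0.
  have [T0|T0] := posnP #|T|; first by rewrite T0 invr0 mulr0 ler01.
  rewrite ler_pdivrMr ?ltr0n // mul1r -natrM ler_nat; apply: leq_trans jn.
  by rewrite leq_mul2r orbT.
rewrite -(@ler_rat algC) ratpow_dot.
pose P := [pred p : bool * {set T} | (40 * #|~: p.2| <= #|T|)%N].
pose t (p : bool * {set T}) i : algC :=
  if mult p.1 p.2 i != 0 then 'chi_i 1%g ^+ 2 * ratr (a p.2) ^+ (k + l) else 0.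
have d_ge0 (i : Iirr [set: {perm T}]%G) : 0 <= 'chi_i 1%g by apply/ltW/irr1_gt0.
have t_ge0 p i : P p -> 0 <= t p i.
  move=> Pp; rewrite /t; case: ifP => // _.
  by rewrite mulr_ge0 ?exprn_ge0 // ler0q a_ge0.
have bound i : `|'chi_i 1%g ^+ 2 * (irr_ratio i g^-1%g ^+ k * (irr_ratio i g^-1%g)^* ^+ l)| <=
    \sum_(p | P p) t p i + 'chi_i 1%g ^+ 2 * M%:R^-1 ^+ (k + l).
  rewrite normrM normrX [`|'chi_i 1%g|]ger0_norm // normrM !normrX norm_conjC -exprD.
  have [f Vf f0] := irr_space_neq0 i.
  have := H T _ _ f g^-1%g (irr_space_isotypic i) Vf f0 nT; rewrite moved_inv => /(_ gK).
  case=> [[b [B [u [Vu u0 uB jn rle]]]]|rle].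
    apply: (@le_trans _ _ (t (b, B) i)).
      rewrite /t /= (mult_neq0 Vu u0 uB) ler_wpM2l ?exprn_ge0 //.
      by rewrite lerXn2r ?nnegrE ?ler0q ?a_ge0.
    rewrite (bigD1 (b, B)) //= -addrA lerDl addr_ge0 //.
      by apply: sumr_ge0 => p /andP[Pp _]; apply: t_ge0.
    by rewrite mulr_ge0 ?exprn_ge0 ?invr_ge0 ?ler0n.
  apply: ler_wpDl; first by apply: sumr_ge0 => p Pp; apply: t_ge0.
  by rewrite ler_wpM2l ?exprn_ge0 // lerXn2r ?nnegrE ?invr_ge0 ?ler0n.
have pos : 0 <= \sum_(i : Iirr [set: {perm T}]%G)
    'chi_i 1%g ^+ 2 * (irr_ratio i g^-1%g ^+ k * (irr_ratio i g^-1%g)^* ^+ l).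
  rewrite -ratpow_dot ler0q mulr_ge0 ?ler0n // sumr_ge0 // => x _.
  by rewrite mulr_ge0 // ratpow_ge0.
rewrite -(ger0_norm pos); apply: le_trans (ler_norm_sum _ _ _) _.
apply: le_trans (ler_sum _ (fun i _ => bound i)) _.
rewrite big_split /= exchange_big /= rmorphD rmorph_sum /= lerD //.
  apply: ler_sum => p Pp; rewrite rmorphM /= ratr_nat [ratr (_ ^+ (k + l))]rmorphXn.
  rewrite -big_mkcond /= -mulr_suml ler_wpM2r ?exprn_ge0 ?ler0q ?a_ge0 //.
  exact: sum_irr1_sqr_le.
rewrite -mulr_suml rmorphM rmorphXn fmorphV /= !ratr_nat ler_wpM2r ?exprn_ge0 ?invr_ge0 ?ler0n //.
have := cfRegE [set: {perm T}]%G 1%g; rewrite eqxx mulr1n cfReg_sum sum_cfunE card_perm_group => <-.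
by rewrite le_eqVlt; apply/orP; left; apply/eqP/eq_bigr => i _; rewrite cfunE expr2.
Qed.

(** * Parity and mixtures of convolution powers *)

Section PoissonMixture.
Variables (T : finType) (F : realFieldType).
Notation Sn := {perm T}.
Notation N := #|{perm T}|.
Notation G := [set: {perm T}]%G.
Implicit Types (g s x y : Sn) (B : {set T}) (C : {set Sn}).

Lemma ratpow_sum1 C (k : nat) : (0 < #|C|)%N -> \sum_x ratpow C k x = 1.
Proof.
move=> C0; elim: k => [|k IH] /=.
  by rewrite (bigD1 1%g) //= eqxx big1 ?addr0 // => x /negPf->.
rewrite exchange_big /= -[RHS]IH; apply: eq_bigr => y _.
rewrite -mulr_sumr -mulr_suml (reindex_inj (mulgI y)) /=.
under eq_bigr => x _ do rewrite mulKg.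
have -> : \sum_x (x \in C)%:R = #|C|%:R :> rat.
  by rewrite -sum1_card natr_sum [RHS]big_mkcond; apply: eq_bigr => x _; case: (x \in C).
by rewrite mulfV ?mulr1 // pnatr_eq0 -lt0n.
Qed.

Lemma ratpow_parity C b (k : nat) x : (forall c, c \in C -> odd_perm c = b) ->
  ratpow C k x != 0 -> odd_perm x = odd k && b.
Proof.
move=> Cb; elim: k x => [|k IH] x /=.
  by have [->|] := eqVneq x 1%g; rewrite ?odd_perm1 ?eqxx.
move=> nz; have [y ] : exists y, ratpow C k y * ((y^-1 * x \in C)%g%:R / #|C|%:R) != 0.
  apply/existsP; apply: contraNT nz => /existsPn H; apply/eqP/big1 => y _.
  by have := H y; rewrite negbK => /eqP.
rewrite mulf_eq0 negb_or => /andP[/IH oy]; case Cy: (y^-1 * x \in C)%g; last by rewrite mul0r eqxx.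
move=> _; have := Cb _ Cy; rewrite odd_permM odd_permV oy.
by case: (odd k) (b) (odd_perm x) => [] [] [].
Qed.

Lemma ratpow_dot_odd C (k l : nat) : (forall c, c \in C -> odd_perm c) -> odd (k + l) ->
  \sum_x ratpow C k x * ratpow C l x = 0.
Proof.
move=> Co okl; apply: big1 => x _; apply/eqP; rewrite mulf_eq0; apply: contraLR okl.
have Cb c : c \in C -> odd_perm c = true by move/Co.
rewrite negb_or => /andP[/(ratpow_parity Cb) ok /(ratpow_parity Cb) ol].
by rewrite oddD; move: ok ol; rewrite !andbT => -> ->; rewrite addbb.
Qed.

Definition near_trivial (p : bool * {set T}) :=
  (40 * #|~: p.2| <= #|T|)%N && (~: p.2 != set0).
Definition weight (p : bool * {set T}) : F := (#|T| ^ (2 * #|~: p.2|))%:R.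
Definition rate (p : bool * {set T}) : F := 1 - 4 * #|~: p.2|%:R / #|T|%:R.
(** The full blocks, which carry the trivial and sign characters, are isolated as [1 + sg ^+ m]. All
    other pairs have a rate below 1. *)
Definition spectral_sum (sg : F) (M m : nat) : F :=
  1 + sg ^+ m + \sum_(p | near_trivial p) weight p * rate p ^+ m + N%:R * M%:R^-1 ^+ m.

Lemma rate_ge0 p : near_trivial p -> 0 <= rate p.
Proof.
case/andP=> jn _; rewrite subr_ge0.
have [T0|T0] := posnP #|T|; first by rewrite T0 invr0 mulr0 ler01.
rewrite ler_pdivrMr ?ltr0n // mul1r -natrM ler_nat; apply: leq_trans jn.
by rewrite leq_mul2r orbT.
Qed.

(** The available bound counts the sign character as 1 even for an odd class. Parity repairs this:
    for odd [k + l] the two powers have disjoint supports and the left side is zero. *)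
Lemma ratpow_dot_le (M : nat) (od : bool) g (k l : nat) :
  (N%:R * (\sum_x ratpow (g ^: G)%g k x * ratpow (g ^: G)%g l x) <=
  \sum_(p : bool * {set T} | (40 * #|~: p.2| <= #|T|)%N)
     (#|T| ^ (2 * #|~: p.2|))%:R * (1 - 4 * #|~: p.2|%:R / #|T|%:R) ^+ (k + l)
  + N%:R * M%:R^-1 ^+ (k + l)) -> (od -> forall c, c \in (g ^: G)%g -> odd_perm c) ->
  N%:R * (\sum_x ratr (ratpow (g ^: G)%g k x) * ratr (ratpow (g ^: G)%g l x)) <=
    spectral_sum ((-1) ^+ od) M (k + l).
Proof.
move=> H Hod; set C := (g ^: G)%g in H Hod *.
have rest0 : 0 <= \sum_(p | near_trivial p) weight p * rate p ^+ (k + l).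
  by apply: sumr_ge0 => p Pp; rewrite mulr_ge0 ?ler0n ?exprn_ge0 ?rate_ge0.
have -> : N%:R * (\sum_x ratr (ratpow C k x) * ratr (ratpow C l x)) =
    ratr (N%:R * \sum_x ratpow C k x * ratpow C l x) :> F.
  rewrite rmorphM /= ratr_nat rmorph_sum; congr (_ * _); apply: eq_bigr => x _.
  by rewrite rmorphM.
have [oddcase|evencase] := boolP (od && odd (k + l)).
  case/andP: oddcase => od1 okl; rewrite ratpow_dot_odd ?mulr0 ?rmorph0 //; last exact: Hod.
  rewrite /spectral_sum od1 expr1 -signr_odd okl expr1 subrr add0r addr_ge0 //.
  by rewrite mulr_ge0 ?exprn_ge0 ?invr_ge0 ?ler0n.
rewrite -(@ler_rat F) in H; apply: le_trans H _.
rewrite rmorphD rmorph_sum /= [ratr (_%:R * M%:R^-1 ^+ _)]rmorphM /=.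
rewrite [ratr (M%:R^-1 ^+ _)]rmorphXn /= fmorphV /= !ratr_nat lerD2r.
have -> : ((-1) ^+ od) ^+ (k + l) = 1 :> F.
  by case: od evencase {Hod} => /=; rewrite ?expr1n // expr1 -signr_odd => /negPf->.
rewrite (bigID (fun p : bool * {set T} => ~: p.2 != set0)) /= addrC; apply: lerD; last first.
  rewrite le_eqVlt; apply/orP; left; apply/eqP; apply: eq_bigr => p _.
  rewrite rmorphM /= ratr_nat [ratr (_ ^+ (k + l))]rmorphXn /= rmorphB /= rmorph1.
  rewrite fmorph_div /= rmorphM /=.
  by rewrite !ratr_nat.
rewrite (eq_bigl (mem [set (false, [set: T]); (true, [set: T])])); last first.
  move=> [b B]; rewrite !inE /= negbK -(inj_eq (@setC_inj T)) setCK setC0 -!pair_eqE /=.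
  have [->|] := eqVneq B setT; last by rewrite !andbF.
  by rewrite setCT cards0 muln0 leq0n; case: b.
rewrite big_setU1 ?inE //= big_set1 /= setCT cards0 muln0 expn0 mulr0 mul0r subr0 expr1n mulr1.
by rewrite rmorph1.
Qed.

(** Both sides are quadratic forms in [a], compared coefficient by coefficient, since [z ^+ (k + l)]
    summed against [a k * a l] is a square. *)
Lemma mixture_bound (sg : F) (M : nat) g (a : nat -> F) (K : nat) :
  (forall k, 0 <= a k) ->
  (forall k l, N%:R * (\sum_x ratr (ratpow (g ^: G)%g k x) * ratr (ratpow (g ^: G)%g l x)) <=
    spectral_sum sg M (k + l)) ->
  N%:R * (\sum_x (\sum_(0 <= k < K) a k * ratr (ratpow (g ^: G)%g k x)) ^+ 2) <=
  (\sum_(0 <= k < K) a k) ^+ 2 + (\sum_(0 <= k < K) a k * sg ^+ k) ^+ 2 +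
  \sum_(p | near_trivial p) weight p * (\sum_(0 <= k < K) a k * rate p ^+ k) ^+ 2 +
  N%:R * (\sum_(0 <= k < K) a k * M%:R^-1 ^+ k) ^+ 2.
Proof.
move=> a0 H; set C := (g ^: G)%g in H *.
have sq (z : nat -> F) : (\sum_(0 <= k < K) a k * z k) ^+ 2 =
    \sum_(0 <= k < K) \sum_(0 <= l < K) (a k * a l) * (z k * z l).
  rewrite expr2 mulr_suml; apply: eq_bigr => k _; rewrite mulr_sumr; apply: eq_bigr => l _.
  by rewrite mulrACA.
have sqX (z : F) : (\sum_(0 <= k < K) a k * z ^+ k) ^+ 2 =
    \sum_(0 <= k < K) \sum_(0 <= l < K) (a k * a l) * z ^+ (k + l).
  by rewrite sq; apply: eq_bigr => k _; apply: eq_bigr => l _; rewrite -exprD.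
have -> : N%:R * (\sum_x (\sum_(0 <= k < K) a k * ratr (ratpow C k x)) ^+ 2) =
    \sum_(0 <= k < K) \sum_(0 <= l < K) (a k * a l) *
      (N%:R * \sum_x ratr (ratpow C k x) * ratr (ratpow C l x)).
  under eq_bigr => x _ do rewrite sq.
  rewrite exchange_big /= mulr_sumr; apply: eq_bigr => k _.
  rewrite exchange_big /= mulr_sumr; apply: eq_bigr => l _.
  by rewrite -mulr_sumr mulrCA.
have -> : \sum_(0 <= k < K) a k = \sum_(0 <= k < K) a k * 1 ^+ k.
  by apply: eq_bigr => k _; rewrite expr1n mulr1.
rewrite !sqX.
under [X in _ <= _ + _ + X + _]eq_bigr => p _ do rewrite sqX.
apply: (@le_trans _ _ (\sum_(0 <= k < K) \sum_(0 <= l < K) (a k * a l) * spectral_sum sg M (k + l))).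
  by apply: ler_sum => k _; apply: ler_sum => l _; rewrite ler_wpM2l // mulr_ge0.
rewrite le_eqVlt; apply/orP; left; apply/eqP.
have -> : \sum_(p | near_trivial p) weight p *
      (\sum_(0 <= k < K) \sum_(0 <= l < K) a k * a l * rate p ^+ (k + l)) =
    \sum_(0 <= k < K) \sum_(0 <= l < K) a k * a l *
      \sum_(p | near_trivial p) weight p * rate p ^+ (k + l).
  under eq_bigr => p _ do rewrite mulr_sumr.
  rewrite exchange_big /=; apply: eq_bigr => k _.
  under eq_bigr => p _ do rewrite mulr_sumr.
  rewrite exchange_big /=; apply: eq_bigr => l _.
  by rewrite mulr_sumr; apply: eq_bigr => p _; rewrite mulrCA.
rewrite mulr_sumr -!big_split /=; apply: eq_bigr => k _.
rewrite mulr_sumr -!big_split /=; apply: eq_bigr => l _.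
rewrite /spectral_sum expr1n; ring.
Qed.
End PoissonMixture.

(** * The heat kernel *)

Local Arguments exp _%_ring_scope.

Section Limits.
Implicit Types (u v : nat -> R) (l : R).

Lemma exp_mulE (x y : R) : exp x * exp y = exp (x + y).
Proof. exact/esym/exp_plus. Qed.

Lemma Un_cv_le u v l l' : (forall k, u k <= v k) -> Un_cv u l -> Un_cv v l' -> l <= l'.
Proof.
move=> uv ul vl; apply/RleP; apply: (Rle_cv_lim _ ul vl) => k; exact/RleP.
Qed.

Lemma Un_cv_const l : Un_cv (fun=> l) l.
Proof. by move=> eps e0; exists 0%N => k _; rewrite RdistE subrr normr0; apply/RltP/RltP. Qed.

Lemma Un_cv_sum (I : Type) (r : seq I) (P : pred I) (u : I -> nat -> R) (l : I -> R) :
  (forall i, P i -> Un_cv (u i) (l i)) ->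
  Un_cv (fun K => \sum_(i <- r | P i) u i K) (\sum_(i <- r | P i) l i).
Proof.
move=> ul; elim: r => [|i r IH].
  rewrite big_nil; have -> : (fun K => \sum_(i <- [::] | P i) u i K) = (fun=> 0).
    by apply/funext => K; rewrite big_nil.
  exact: Un_cv_const.
rewrite big_cons; have -> : (fun K => \sum_(i <- i :: r | P i) u i K) =
    (fun K => if P i then u i K + \sum_(i <- r | P i) u i K else \sum_(i <- r | P i) u i K).
  by apply/funext => K; rewrite big_cons.
by case: ifP => Pi //; apply: CV_plus => //; apply: ul.
Qed.

Lemma Un_cv_sqr u l : Un_cv u l -> Un_cv (fun K => u K ^+ 2) (l ^+ 2).
Proof. by move=> ul; apply: (CV_mult _ _ _ _ ul ul). Qed.

Lemma Un_cv_scale c u l : Un_cv u l -> Un_cv (fun K => c * u K) (c * l).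
Proof. by move=> ul; apply: CV_mult => //; apply: Un_cv_const. Qed.

Definition poisson (t : R) (k : nat) : R := (t ^+ k / (k`!)%:R)%R.

Lemma poisson_ge0 t k : 0 <= t -> 0 <= poisson t k.
Proof. by move=> t0; rewrite divr_ge0 ?exprn_ge0 ?ler0n. Qed.

Lemma poisson_cv t z : Un_cv (fun K => \sum_(0 <= k < K.+1) poisson t k * z ^+ k) (exp (t * z)).
Proof.
have := proj2_sig (exist_exp (t * z)); rewrite /exp_in /infinite_sum -/(exp (t * z)) => H.
move=> eps e0; have [N0 HN] := H eps e0; exists N0 => k /HN.
rewrite sum_f_R0E; set S := \sum_(0 <= i < k.+1) _.
suff -> : S = \sum_(0 <= i < k.+1) poisson t i * z ^+ i by [].
apply: eq_bigr => i _.
by rewrite RpowE INRE factE RinvE RmultE exprMn /poisson mulrC mulrAC.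
Qed.

Lemma Rseries_cv u l : Un_cv (sum_f_R0 u) l -> Rseries u = l.
Proof.
move=> ul; apply: (UL_sequence (sum_f_R0 u)) => //.
rewrite /Rseries /Rlim; apply: (epsilon_spec (inhabits 0%R) (fun l => Un_cv (fun N => sum_f_R0 u N) l)).
by exists l.
Qed.
End Limits.

Section HeatKernel.
Variables (n : nat) (g : {perm 'I_n}).
Notation C := (g ^: [set: {perm 'I_n}])%g.
Notation N := #|{perm 'I_n}|.
Notation Q k x := (ratr (ratpow C k x) : R).

Lemma class_card_gt0 : (0 < #|C|)%N.
Proof. by apply/card_gt0P; exists g; apply: class_refl. Qed.

Lemma convpow_ratpow k x : convpow (unif C) k x = Q k x.
Proof.
elim: k x => [|k IH] x; first by rewrite /= ratr_nat /delta1; case: eqP.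
rewrite /= rmorph_sum; apply: eq_bigr => y _; rewrite IH rmorphM /= fmorph_div /= !ratr_nat.
by rewrite /unif INRE RinvE RmultE; case: ifP => _; rewrite ?mul1r ?mul0r.
Qed.

Lemma Q_ge0 k x : 0 <= Q k x.
Proof. by rewrite ler0q ratpow_ge0. Qed.

Lemma Q_sum k : \sum_x Q k x = 1.
Proof. by rewrite -rmorph_sum (ratpow_sum1 _ class_card_gt0) rmorph1. Qed.

Lemma Q_le1 k x : Q k x <= 1.
Proof.
by rewrite -(Q_sum k) (bigD1 x) //= lerDl sumr_ge0 // => y _; apply: Q_ge0.
Qed.

(** Comparison with the exponential series gives convergence, so the classically chosen [Rseries] is
    the true sum. *)
Lemma heat_cv (t : R) x : 0 <= t ->
  Un_cv (fun K => exp (- t) * \sum_(0 <= k < K.+1) poisson t k * Q k x) (heat C t x).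
Proof.
move=> t0; pose u k := Rmult (Rdiv (pow t k) (INR (fact k))) (convpow (unif C) k x).
have uE k : u k = poisson t k * Q k x.
  by rewrite /u convpow_ratpow RpowE INRE factE RdivE RmultE.
have sE K : sum_f_R0 u K = \sum_(0 <= k < K.+1) poisson t k * Q k x.
  by rewrite sum_f_R0E; apply: eq_bigr => k _; rewrite uE.
have [l ul] : {l | Un_cv (sum_f_R0 u) l}.
  apply: (Rseries_CV_comp u (poisson t)) => [k|].
    rewrite uE; split; apply/RleP; first by rewrite mulr_ge0 ?poisson_ge0 ?Q_ge0.
    by rewrite ler_piMr ?poisson_ge0 ?Q_le1.
  exists (exp (t * 1)); have := poisson_cv t 1; congr Un_cv; apply/funext => K.
  by rewrite sum_f_R0E; apply: eq_bigr => k _; rewrite expr1n mulr1.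
rewrite /heat (Rseries_cv ul); apply: Un_cv_scale; move: ul; congr Un_cv; exact/funext.
Qed.

Lemma heat_sum (t : R) : 0 <= t -> \sum_x heat C t x = 1.
Proof.
move=> t0; apply: (UL_sequence (fun K => \sum_x exp (- t) * \sum_(0 <= k < K.+1) poisson t k * Q k x)).
  by apply: Un_cv_sum => x _; apply: heat_cv.
have -> : 1 = exp (- t) * exp (t * 1) :> R by rewrite exp_mulE mulr1 addNr exp_0.
have := Un_cv_scale (exp (- t)) (poisson_cv t 1); congr Un_cv; apply/funext => K.
rewrite -mulr_sumr; congr (_ * _); rewrite exchange_big /=; apply: eq_bigr => k _.
by rewrite -mulr_sumr Q_sum expr1n.
Qed.

Lemma heat_eq0 (t : R) x :
  0 <= t -> (forall c, c \in C -> ~~ odd_perm c) -> odd_perm x -> heat C t x = 0.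
Proof.
move=> t0 Ce ox; apply: (UL_sequence _ _ _ (heat_cv x t0)).
have -> : (fun K => exp (- t) * \sum_(0 <= k < K.+1) poisson t k * Q k x) = (fun=> 0).
  apply/funext => K; rewrite big1 ?mulr0 // => k _.
  suff -> : ratpow C k x = 0 by rewrite rmorph0 mulr0.
  apply/eqP; apply: contraTT ox => nz.
  by rewrite (ratpow_parity (b := false) _ nz) ?andbF // => c /Ce/negPf.
exact: Un_cv_const.
Qed.

(** Pass to the limit in [mixture_bound]: the Poisson mixture of the powers of [z] tends to
    [exp (t * (z - 1))]. *)
Lemma heat_l2_bound (t sg : R) (M : nat) : 0 <= t ->
  (forall k l, N%:R * (\sum_x Q k x * Q l x) <= spectral_sum 'I_n sg M (k + l)) ->
  N%:R * (\sum_x heat C t x ^+ 2) <=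
  1 + exp (t * (sg - 1)) ^+ 2 +
  \sum_(p : bool * {set 'I_n} | near_trivial p) weight R p * exp (t * (rate R p - 1)) ^+ 2 +
  N%:R * exp (t * (M%:R^-1 - 1)) ^+ 2.
Proof.
move=> t0 H; pose S z K := exp (- t) * \sum_(0 <= k < K.+1) poisson t k * z ^+ k.
have Scv z : Un_cv (S z) (exp (t * (z - 1))).
  rewrite mulrBr mulr1 addrC -exp_mulE; exact: Un_cv_scale (poisson_cv t z).
have S1 : exp (t * (1 - 1)) ^+ 2 = 1 by rewrite subrr mulr0 exp_0 expr1n.
rewrite -[X in _ <= X + _ + _ + _]S1.
apply: (@Un_cv_le
  (fun K => N%:R * \sum_x (exp (- t) * \sum_(0 <= k < K.+1) poisson t k * Q k x) ^+ 2)
  (fun K => S 1 K ^+ 2 + S sg K ^+ 2 +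
     \sum_(p : bool * {set 'I_n} | near_trivial p) weight R p * S (rate R p) K ^+ 2 +
     N%:R * S M%:R^-1 K ^+ 2)).
- move=> K; have := mixture_bound (a := poisson t) K.+1 (fun k => poisson_ge0 k t0) H.
  have e2 : 0 <= exp (- t) ^+ 2 by apply: sqr_ge0.
  move=> /(ler_wpM2l e2).
  have pull (I : finType) (P : pred I) (w z : I -> R) :
      \sum_(i | P i) w i * (exp (- t) * z i) ^+ 2 = exp (- t) ^+ 2 * \sum_(i | P i) w i * z i ^+ 2.
    by rewrite [RHS]mulr_sumr; apply: eq_bigr => i _; rewrite exprMn mulrCA.
  have -> : \sum_(0 <= k < K.+1) poisson t k = \sum_(0 <= k < K.+1) poisson t k * 1 ^+ k.
    by apply: eq_bigr => k _; rewrite expr1n mulr1.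
  congr (_ <= _); last by rewrite /S pull !exprMn; ring.
  have := pull _ xpredT (fun=> 1) (fun x => \sum_(0 <= k < K.+1) poisson t k * Q k x).
  under eq_bigr => x _ do rewrite mul1r.
  under [X in _ = _ * X]eq_bigr => x _ do rewrite mul1r.
  by move=> ->; ring.
- by apply: Un_cv_scale; apply: Un_cv_sum => x _; apply: Un_cv_sqr; apply: heat_cv.
apply: CV_plus; last by apply: Un_cv_scale; apply: Un_cv_sqr.
apply: CV_plus; last by apply: Un_cv_sum => p _; apply: Un_cv_scale; apply: Un_cv_sqr.
by apply: CV_plus; apply: Un_cv_sqr.
Qed.
End HeatKernel.

(** * Estimates at time (1 + eps) (n/2) log n *)

Section Numerics.

Lemma sum_expr_card (F : comRingType) (T : finType) (z : F) :
  \sum_(B : {set T}) z ^+ #|~: B| = (z + 1) ^+ #|T|.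
Proof.
rewrite (reindex_inj (@setC_inj T)) /=; under eq_bigr => B _ do rewrite setCK.
rewrite -prodr_const bigA_distr; apply: eq_big => [B|B _]; first by rewrite inE.
by rewrite -prodr_const big_mkcond.
Qed.

(** A converse to Bernoulli's inequality, used to bound (1 + 1/n^2)^n by n/(n - 1). *)
Lemma expr1D_le (F : realFieldType) (m : nat) (z : F) : 0 <= z ->
  (z + 1) ^+ m * (1 - m%:R * z) <= 1.
Proof.
move=> z0; elim: m => [|m IH]; first by rewrite expr0 mul0r subr0 mul1r.
apply: le_trans IH; rewrite exprSr -mulrA ler_wpM2l ?exprn_ge0 ?addr_ge0 //.
have -> : (z + 1) * (1 - m.+1%:R * z) = 1 - m%:R * z - m.+1%:R * z ^+ 2.
  by rewrite -natr1; ring.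
by rewrite lerBlDr lerDl mulr_ge0 ?sqr_ge0.
Qed.

Lemma fact_le_expn m : (m`! * m <= m ^ m)%N.
Proof.
case: m => // m; rewrite mulnC [X in (_ <= X)%N]expnS leq_mul2l /=.
elim: m => // m IH; rewrite factS expnS leq_mul2l /=; apply: leq_trans IH _.
by case: m => // m; rewrite leq_exp2r.
Qed.

Lemma exp_le_mono (x y : R) : x <= y -> exp x <= exp y.
Proof.
rewrite le_eqVlt => /predU1P[->//|xy]; apply/ltW/RltP/exp_increasing; exact/RltP.
Qed.

Variables (n : nat) (eps : R).
Hypotheses (n2 : (2 <= n)%N) (eps0 : 0 < eps).
Let L : R := ln n%:R.
Let t : R := ((1 + eps) * (n%:R / 2 * L))%R.

Lemma natn_gt0 : 0 < n%:R :> R. Proof. by rewrite ltr0n ltnW. Qed.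

Lemma expL k : exp (- (L *+ k)) = (n%:R ^+ k)^-1.
Proof.
have /RltP n0 := natn_gt0.
by rewrite exp_Ropp RinvE -expRX /L exp_ln.
Qed.

Lemma L_ge0 : 0 <= L.
Proof.
have [h|/ltW//] := leP L 0; have := exp_le_mono h; rewrite expR0 /L exp_ln; last exact/RltP/natn_gt0.
by rewrite lern1 leqNgt n2.
Qed.

Lemma t_ge0 : 0 <= t.
Proof.
apply: mulr_ge0; first by rewrite addr_ge0 // ltW.
by rewrite mulr_ge0 ?L_ge0 // divr_ge0 ?ler0n.
Qed.

(** By the choice of [t] the left side equals n to the power -(1 + eps)[a]n. *)
Lemma exp_rate (a : R) (k : nat) : k%:R <= (1 + eps) * (a * n%:R) ->
  exp (t * - a) ^+ 2 <= (n%:R ^+ k)^-1.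
Proof.
move=> ka; rewrite -expL expRX; apply: exp_le_mono.
have -> : t * - a *+ 2 = - ((1 + eps) * (a * n%:R) * L) by rewrite /t -mulr_natl; field.
by rewrite lerN2 -[L *+ k]mulr_natl ler_wpM2r ?L_ge0.
Qed.

Lemma near_trivial_sum :
  \sum_(p : bool * {set 'I_n} | near_trivial p) weight R p * exp (t * (rate R p - 1)) ^+ 2
    <= 2 / (n%:R - 1).
Proof.
have n0 := natn_gt0; have n1 : 1 < n%:R :> R by rewrite ltr1n.
(* For a complement of size j the weight n^(2j) meets a decay n^(-4j), leaving [z]^j. The binomial
   theorem sums this over all subsets, once for each sign. *)
pose z : R := n%:R ^- 2; have z0 : 0 <= z by rewrite invr_ge0 exprn_ge0.
apply: (@le_trans _ _ (\sum_(p : bool * {set 'I_n} | ~: p.2 != set0) z ^+ #|~: p.2|)).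
  rewrite [X in X <= _](bigID (fun p : bool * {set 'I_n} => (40 * #|~: p.2| <= #|'I_n|)%N)) /=.
  rewrite [X in _ + X]big1 ?addr0 => [|p]; last by rewrite /near_trivial => /andP[/andP[-> ]].
  rewrite [X in _ <= X](bigID (fun p : bool * {set 'I_n} => (40 * #|~: p.2| <= #|'I_n|)%N)) /=.
  apply: ler_wpDr; first by apply: sumr_ge0 => p _; rewrite exprn_ge0.
  rewrite (eq_bigl (fun p : bool * {set 'I_n} =>
    (~: p.2 != set0) && (40 * #|~: p.2| <= #|'I_n|)%N)); last first.
    by move=> p; rewrite /near_trivial andbC andbA andbb andbC.
  apply: ler_sum => p _; set j := #|~: p.2|.
  have -> : rate R p - 1 = - (4 * j%:R / n%:R) by rewrite /rate card_ord -/j; ring.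
  have h : (4 * j)%:R <= (1 + eps) * (4 * j%:R / n%:R * n%:R) :> R.
    rewrite divfK ?lt0r_neq0 // natrM ler_peMl ?mulr_ge0 ?ler0n //.
    by rewrite lerDl ltW.
  rewrite /weight card_ord -/j natrX.
  have -> : z ^+ j = n%:R ^+ (2 * j) * (n%:R ^+ (4 * j))^-1.
    have -> : (4 * j = 2 * j + 2 * j)%N by lia.
    by rewrite exprD invfM mulrA mulfV ?mul1r ?expf_neq0 ?lt0r_neq0 // /z exprVn exprM.
  by rewrite ler_wpM2l ?exprn_ge0 // exp_rate.
have -> : \sum_(p : bool * {set 'I_n} | ~: p.2 != set0) z ^+ #|~: p.2| =
    2 * ((z + 1) ^+ n - 1).
  rewrite (eq_bigl (fun p : bool * {set 'I_n} => true && (~: p.2 != set0))) //.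
  rewrite -(pair_big xpredT (fun B : {set 'I_n} => ~: B != set0) (fun _ B => z ^+ #|~: B|)) /=.
  rewrite sumr_const card_bool -[LHS]mulr_natl; congr (_ * _).
  rewrite -[n in RHS]card_ord -sum_expr_card [in RHS](bigD1 setT) //= setCT cards0.
  rewrite expr0 addrAC subrr add0r.
  by apply: eq_bigl => B; rewrite -(inj_eq (@setC_inj _)) setCK setC0.
rewrite ler_wpM2l // lerBlDr -[X in _ <= X + 1]mul1r.
have h := expr1D_le n z0.
have n10 : 0 < n%:R - 1 :> R by rewrite subr_gt0.
have ez : 1 - n%:R * z = (n%:R - 1) / n%:R by rewrite /z; field; rewrite lt0r_neq0.
rewrite ez in h.
have -> : 1 * (n%:R - 1)^-1 + 1 = ((n%:R - 1) / n%:R)^-1 :> R.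
  by field; rewrite !lt0r_neq0.
by rewrite -[X in _ <= X]mul1r ler_pdivlMr ?divr_gt0.
Qed.

(** The hypothesis on [M] makes the decay at least n^(-n), which beats n! by a further factor n. *)
Lemma bulk_term (M : nat) : 1 <= (1 + eps) * (1 - M%:R^-1) ->
  #|{perm 'I_n}|%:R * exp (t * (M%:R^-1 - 1)) ^+ 2 <= n%:R^-1 :> R.
Proof.
move=> hM; have n0 := natn_gt0.
have := @exp_rate (1 - M%:R^-1) n; rewrite opprB => h.
apply: (@le_trans _ _ (#|{perm 'I_n}|%:R * (n%:R ^+ n)^-1)).
  rewrite ler_wpM2l ?ler0n //; apply: h.
  by rewrite mulrA ler_peMl ?ler0n.
rewrite ler_pdivrMr ?exprn_gt0 // mulrC ler_pdivlMr // -natrX -natrM ler_nat.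
by rewrite card_Sn fact_le_expn.
Qed.

Lemma sign_term : exp (t * (-1 - 1)) ^+ 2 <= n%:R^-1.
Proof.
have := @exp_rate 2%R 1; rewrite expr1 => h.
have -> : -1 - 1 = - 2 :> R by ring.
apply: h; have n1 : 1 <= n%:R :> R by rewrite ler1n ltnW.
have : 0 < eps * n%:R by rewrite mulr_gt0 ?natn_gt0.
lra.
Qed.
End Numerics.

(** * Convergence in d_2 for odd and for even classes *)

Section Assembly.

Lemma sum_sqr_unif (I : finType) (A : {set I}) (h : I -> R) : (0 < #|A|)%N ->
  \sum_(x in A) h x = 1 ->
  #|A|%:R * (\sum_(x in A) (h x - #|A|%:R^-1) ^+ 2) = #|A|%:R * (\sum_(x in A) h x ^+ 2) - 1.
Proof.
move=> A0 h1; have a0 : #|A|%:R != 0 :> R by rewrite pnatr_eq0 -lt0n.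
have -> : \sum_(x in A) (h x - #|A|%:R^-1) ^+ 2 =
    \sum_(x in A) h x ^+ 2 - 2 * #|A|%:R^-1 * \sum_(x in A) h x + \sum_(x in A) #|A|%:R^-1 ^+ 2.
  rewrite mulr_sumr -sumrB -big_split /=; apply: eq_bigr => x _; ring.
by rewrite h1 sumr_const -[_ *+ _]mulr_natl; field.
Qed.

Lemma dist2E n (A : {set {perm 'I_n}}) (p : Sfun n) :
  dist2 A p (unif A) = Num.sqrt (#|A|%:R * \sum_(x in A) (p x - #|A|%:R^-1) ^+ 2).
Proof.
rewrite /dist2 RsqrtE INRE; congr (Num.sqrt (_ * _)); apply: eq_bigr => x Ax.
by rewrite RpowE /unif Ax INRE.
Qed.

Lemma conjugacy_class_repr (gT : finGroupType) (G : {group gT}) (C : {set gT}) :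
  C \in classes G -> C = (repr C ^: G)%g.
Proof.
move=> /imsetP[x Gx ->]; have [y Gy ->] := repr_class G x.
by rewrite classGidl.
Qed.

Variable eps : R.
Hypothesis eps0 : 0 < eps.

(** For even classes the sign character does not decay, whence the leading 2, later compensated by
    the index of the alternating group. *)
Lemma heat_l2_small (od : bool) : exists K n0 : nat,
  forall n (g : {perm 'I_n}), (n0 <= n)%N -> (K <= #|moved g|)%N -> (2 <= n)%N ->
  (od -> forall c, c \in (g ^: [set: {perm 'I_n}])%g -> odd_perm c) ->
  #|{perm 'I_n}|%:R * (\sum_x heat (g ^: [set: {perm 'I_n}])%g ((1 + eps) * tn n)%R x ^+ 2)
   <= (if od then 1 else 2) + 4 / (n%:R - 1).
Proof.
(* Then (1 + [eps])/[M] <= [eps], which is the condition of [bulk_term]. *)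
pose M := (Num.bound ((1 + eps) / eps)%R).
have hM : ((1 + eps) / eps < M%:R)%R by apply: archi_boundP; rewrite divr_ge0 ?addr_ge0 // ltW.
have M0 : (0 < M)%N.
  rewrite -(ltr0n R); apply: le_lt_trans hM; rewrite divr_ge0 ?addr_ge0 // ltW //.
have hM' : (1 <= (1 + eps) * (1 - M%:R^-1))%R.
  move: hM; rewrite ltr_pdivrMr // => hM.
  have MR : 0 < M%:R :> R by rewrite ltr0n.
  have h : (1 + eps) / M%:R <= eps by rewrite ler_pdivrMr // mulrC ltW.
  lra.
have [K [n0 H]] := ratpow_bound M0; exists K, n0 => n g nn0 gK n2 godd.
pose t : R := ((1 + eps) * (n%:R / 2 * ln n%:R))%R.
have -> : ((1 + eps) * tn n)%R = t by rewrite /t /tn INRE.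
have t0 : (0 <= t)%R by apply: t_ge0.
have card_n : #|'I_n| = n by rewrite card_ord.
have := @heat_l2_bound n g t ((-1) ^+ od) M t0 _.
move=> /(_ _) B; apply: le_trans (B _) _.
  move=> k l; apply: ratpow_dot_le godd; apply: H => //; by rewrite card_n.
have h1 := near_trivial_sum n2 eps0; have h2 := bulk_term n2 hM'.
have h3 := sign_term n2 eps0.
have n0' : 0 < n%:R :> R by rewrite ltr0n ltnW.
have n1' : 0 < n%:R - 1 :> R by rewrite subr_gt0 ltr1n.
have inv : n%:R^-1 <= (n%:R - 1)^-1 :> R by rewrite lef_pV2 ?posrE // lerBlDr lerDl.
rewrite -/t in h1 h2 h3.
have i0 : 0 <= (n%:R - 1)^-1 :> R by rewrite invr_ge0 ltW.
apply: (le_trans (lerD (lerD (lexx _) h1) h2)).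
case: od godd B => godd B.
  rewrite expr1; lra.
rewrite expr0 subrr mulr0 expR0 expr1n; lra.
Qed.

Lemma dist2_cv0 (A : forall n, {set {perm 'I_n}}) (p : forall n, Sfun n) (c : R) (n1 : nat) :
  (forall n, (n1 <= n)%N -> (2 <= n)%N ->
     #|A n|%:R * (\sum_(x in A n) (p n x - #|A n|%:R^-1) ^+ 2) <= c / (n%:R - 1)) ->
  Un_cv (fun n => dist2 (A n) (p n) (unif (A n))) 0%R.
Proof.
move=> H e /RltP e0; pose m := Num.bound (`|c| / e ^+ 2 + 1)%R.
have e2 : 0 < e ^+ 2 by rewrite exprn_gt0.
have hm : (`|c| / e ^+ 2 + 1 < m%:R)%R.
  by apply: archi_boundP; rewrite addr_ge0 // divr_ge0 // ltW.
exists (maxn (maxn n1 2) m) => n /ssrnat.leP; rewrite !geq_max => /andP[/andP[n1n n2] mn].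
have n10 : 0 < n%:R - 1 :> R by rewrite subr_gt0 ltr1n.
rewrite dist2E RdistE subr0 ger0_norm ?sqrtr_ge0 //; apply/RltP.
rewrite -[e]ger0_norm ?ltW // -sqrtr_sqr ltr_sqrt //.
apply: le_lt_trans (H n n1n n2) _; rewrite ltr_pdivrMr // mulrC -ltr_pdivrMr //.
apply: (@le_lt_trans _ _ (`|c| / e ^+ 2)); first by rewrite ler_wpM2r ?ler_norm // invr_ge0 ltW.
rewrite ltrBrDr; apply: lt_le_trans hm _; by rewrite ler_nat.
Qed.
End Assembly.

Local Open Scope R_scope.

Theorem theorem5p6 :
  forall (C : forall n : nat, {set {perm 'I_n}}),
    (forall n : nat, C n \in classes [set: {perm 'I_n}]) ->
    (forall M : nat, exists N : nat, forall n : nat,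
        (N <= n)%nat -> (M <= supp (C n))%nat) ->
    forall eps : R, 0 < eps ->
      ((forall n : nat, (2 <= n)%nat -> forall g, g \in C n -> odd_perm g) ->
        Un_cv (fun n => dist2 [set: {perm 'I_n}]
                          (heat (C n) ((1 + eps) * tn n))
                          (unif [set: {perm 'I_n}])) 0)
      /\
      ((forall n : nat, (2 <= n)%nat -> forall g, g \in C n -> ~~ odd_perm g) ->
        Un_cv (fun n => dist2 (Alt 'I_n)
                          (heat (C n) ((1 + eps) * tn n))
                          (unif (Alt ('I_n)))) 0).
Proof.
move=> C Cclass Csupp eps /RltP eps0.
have t0 n : (2 <= n)%N -> (0 <= ((1 + eps) * tn n)%R :> R)%R.
  by move=> n2; rewrite /tn INRE; apply: t_ge0.
have CE n : C n = (repr (C n) ^: [set: {perm 'I_n}])%g := conjugacy_class_repr (Cclass n).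
split=> Cpar.
  have [K [n0 H]] := heat_l2_small eps0 true; have [n1 Hn1] := Csupp K.
  apply: (@dist2_cv0 _ _ 4%R (maxn n0 n1)) => n; rewrite geq_max => /andP[n0n n1n] n2.
  have cG : #|[set: {perm 'I_n}]| = #|{perm 'I_n}| by rewrite cardsT.
  rewrite sum_sqr_unif; last 2 first.
  - by apply/card_gt0P; exists 1%g; rewrite inE.
  - by rewrite (eq_bigl xpredT) => [|x]; rewrite ?inE // CE; apply: heat_sum; apply: t0.
  rewrite cG (eq_bigl xpredT) => [|x]; last by rewrite inE.
  rewrite lerBlDl CE; apply: H => // [|_ c]; first exact: Hn1.
  by rewrite -CE; apply: Cpar.
have [K [n0 H]] := heat_l2_small eps0 false; have [n1 Hn1] := Csupp K.
apply: (@dist2_cv0 _ _ 2%R (maxn n0 n1)) => n; rewrite geq_max => /andP[n0n n1n] n2.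
(* The heat kernel lives on the alternating group, of half the order, so halving 2 + 4/(n - 1)
   leaves 1 + 2/(n - 1). *)
have cA : (2 * #|Alt 'I_n|)%N = #|{perm 'I_n}|.
  by rewrite card_Alt ?card_ord // card_Sn.
have heven c : c \in (repr (C n) ^: [set: {perm 'I_n}])%g -> ~~ odd_perm c.
  by rewrite -CE; apply: Cpar.
have offA x : x \notin Alt 'I_n -> heat (C n) ((1 + eps) * tn n)%R x = 0%R.
  by rewrite Alt_even negbK CE => ox; apply: heat_eq0 => //; apply: t0.
rewrite sum_sqr_unif; last 2 first.
- by apply/card_gt0P; exists 1%g; rewrite group1.
- rewrite -[RHS](heat_sum (repr (C n)) (t0 n n2)) -CE [LHS]big_mkcond.
  by apply: eq_bigr => x _; case: ifP => // /negbT/offA.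
have {H} := H n (repr (C n)) n0n (Hn1 n n1n) n2 (fun h => False_ind _ (notF h)).
rewrite -CE -cA natrM => H.
have -> : (\sum_(x in Alt 'I_n) heat (C n) ((1 + eps) * tn n)%R x ^+ 2 =
    \sum_x heat (C n) ((1 + eps) * tn n)%R x ^+ 2)%R.
  by rewrite big_mkcond; apply: eq_bigr => x _; case: ifP => // /negbT/offA ->; rewrite expr0n.
rewrite lerBlDr; move: H; set S := (\sum_x _)%R; set a := (#|_|%:R : R)%R.
set i := (_ - 1)^-1%R => H; lra.
Qed.
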